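(* Let $k\ge 1$. A graph $G$ is $k$-level if and only if $G$ has no minor isomorphic to $\operatorname{cone}(H)$ for any minimally biconnected graph $H$ on $k+1$ vertices.
   Context: A graph $G$ is $k$-level if the base configuration $V_{\mathcal{M}(G)}=\{\mathbf{1}_T: T \text{ a spanning forest of } G\}\subset\mathbb{R}^{E(G)}$ of its graphic matroid is $k$-level, i.e. every facet-defining affine function takes at most $k$ distinct values on it (for a finite point set $V$ and affine $\ell\ge 0$ on $V$, $\{v:\ell(v)=0\}$ is a face; inclusion-maximal faces other than $V$ are facets, and the corresponding $\ell$ are facet-defining). The cone over $H=(V,E)$ with apex $w\notin V$ is $(V\cup\{w\},E\cup\{wv:v\in V\})$. A graph is minimally biconnected if it is biconnected and deleting any edge destroys biconnectivity. *)

(* Defs.v *)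
(* Finite simple graphs are symmetric irreflexive relations
   g : rel V on a finType V. *)
From HB Require Import structures.
From mathcomp Require Import all_boot all_order all_algebra.
Set Implicit Arguments. Unset Strict Implicit. Unset Printing Implicit Defensive.
Import Order.TTheory GRing.Theory Num.Theory.
Local Open Scope ring_scope.

Section Graphs.
Variable V : finType.
Implicit Types (g : rel V) (S : {set V}).

Definition edges g : {set {set V}} := [set [set p.1; p.2] | p in [pred p : V * V | g p.1 p.2]].

Definition acyclic (F : {set {set V}}) : Prop :=
  ~ exists c : seq V,
      [/\ uniq c, (3 <= size c)%N & cycle (fun x y => [set x; y] \in F) c].

Definition spanning_forest g (T : {set {set V}}) : Prop :=
  [/\ T \subset edges g, acyclic T &
      forall e, e \in edges g -> e \notin T -> ~ acyclic (e |: T)].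

Definition connected_in g S : Prop :=
  forall x y, x \in S -> y \in S ->
    connect [rel a b | [&& g a b, a \in S & b \in S]] x y.

(* Biconnected: at least 2 vertices, connected, and no cut vertex
   (so K_2 is biconnected). *)
Definition biconnected g : Prop :=
  (2 <= #|V|)%N /\ connected_in g setT /\
  forall v : V, connected_in g (~: [set v]).

Definition delete_edge g (x y : V) : rel V :=
  [rel a b | g a b && ([set a; b] != [set x; y])].

Definition minimally_biconnected g : Prop :=
  biconnected g /\ forall x y, g x y -> ~ biconnected (delete_edge g x y).

End Graphs.

Definition cone (W : finType) (h : rel W) : rel (option W) :=
  fun x y => match x, y with
             | Some a, Some b => h a b
             | None, Some _ | Some _, None => true
             | None, None => false
             end.

Definition has_minor (V W : finType) (g : rel V) (h : rel W) : Prop :=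
  exists B : W -> {set V},
    [/\ forall w, B w != set0,
        forall w w', w != w' -> [disjoint B w & B w'],
        forall w, connected_in g (B w) &
        forall w w', h w w' -> exists x y, [/\ x \in B w, y \in B w' & g x y]].

(* Base configuration of the graphic matroid: points 1_T in R^{E(G)} for T a
   spanning forest.  An affine function l(x) = c + sum_e a_e x_e evaluates on
   1_T to c + sum_{e in T} a_e. *)
Section Level.
Variables (R : realFieldType) (V : finType) (g : rel V).

Definition aff_eval (c : R) (a : {set V} -> R) (T : {set {set V}}) : R :=
  c + \sum_(e in T) a e.

Definition nonneg_on_base (c : R) (a : {set V} -> R) : Prop :=
  forall T, spanning_forest g T -> 0 <= aff_eval c a T.

(* l is facet-defining: l >= 0 on the configuration, its zero set (a face) is
   not the whole configuration, and every face containing it is either it or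
   the whole configuration. *)
Definition facet_defining (c : R) (a : {set V} -> R) : Prop :=
  [/\ nonneg_on_base c a,
      exists T, spanning_forest g T /\ aff_eval c a T != 0 &
      forall (c' : R) (a' : {set V} -> R), nonneg_on_base c' a' ->
        (forall T, spanning_forest g T -> aff_eval c a T = 0 ->
                   aff_eval c' a' T = 0) ->
        (forall T, spanning_forest g T -> aff_eval c' a' T = 0 ->
                   aff_eval c a T = 0)
        \/ (forall T, spanning_forest g T -> aff_eval c' a' T = 0)].

Definition k_level (k : nat) : Prop :=
  forall (c : R) (a : {set V} -> R), facet_defining c a ->
    exists s : seq R, (size s <= k)%N /\
      forall T, spanning_forest g T -> aff_eval c a T \in s.
End Level.

(* Main.v *)
(* A facet-defining function is nonnegative on spanning forests, so by the
   greedy exchange argument its zero set is contained in that of a rank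
   inequality |T cap E[S]| <= |S| - 1, or of x_e >= 0; by maximality of the
   facet the two functions are proportional.  Minimality of S forces G[S] to be
   biconnected, and proportionality with the dual inequality of a component K
   of G - S shows that a facet with more than k values yields k+1 vertices of S
   attached to K.  Contracting K to the apex, and contracting G[S] along edges
   that preserve biconnectivity while keeping k+1 attached vertices, gives
   cone(H).  Conversely a model of cone(H) yields a valid rank inequality; any
   facet that contains its face but misses one chosen forest has equal
   coefficients on the edges over H and equal coefficients on the spokes (basis
   exchanges), hence takes k+1 values when the edges of a spanning tree of H
   are replaced one by one by spokes. *)
Require Import Defs.
From mathcomp Require Import all_boot all_order all_algebra.
From mathcomp Require Import zify lra.
From Stdlib Require Import Classical.
Set Implicit Arguments. Unset Strict Implicit. Unset Printing Implicit Defensive.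
Import Order.TTheory GRing.Theory Num.Theory.

(** * Forests and rank in the graphic matroid *)

(** All spanning forests have the same number of edges, so one facet has many coefficient vectors,
    and only values on spanning forests are ever compared. This freedom produces the attached
    vertices: the upper bound on edges inside S and the lower bound on edges meeting K are two
    expressions of the same facet, so each edge that a forest loses inside S is regained at K. Rank
    never appears as a function: bounds come from Steinitz exchange between an independent set and a
    spanning set, and the spanning set may contain pairs that are not edges of the graph. The
    definition of a facet does not ask for a zero, so nonvanishing functions are treated apart; so
    is k = 1, because an inequality x_e >= 0 can already take two values. *)

Lemma connect_map (A B : finType) (e : rel A) (e' : rel B) (f : A -> B) :
  (forall x y, e x y -> connect e' (f x) (f y)) ->
  forall x y, connect e x y -> connect e' (f x) (f y).
Proof.
move=> ef x y /connectP[p]; elim: p x => [|z p IH] x /=.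
  by move=> _ ->; exact: connect0.
by move=> /andP[xz zp] yl; apply: connect_trans (ef _ _ xz) (IH _ zp yl).
Qed.

Lemma connect_exit (A : finType) (e : rel A) (C : {pred A}) x y :
  connect e x y -> x \in C -> y \notin C ->
  exists a b, [/\ e a b, a \in C & b \notin C].
Proof.
move=> /connectP[p]; elim: p x => [|z p IH] x /=.
  by move=> _ -> ->.
move=> /andP[xz zp] yl xC yC; case: (boolP (z \in C)) => zC; last by exists x, z.
exact: (IH z).
Qed.

Lemma set2_inj (V : finType) (x y u v : V) :
  [set x; y] = [set u; v] -> (x = u /\ y = v) \/ (x = v /\ y = u).
Proof.
move=> E.
have : x \in [set u; v] by rewrite -E set21.
have : y \in [set u; v] by rewrite -E set22.
have : u \in [set x; y] by rewrite E set21.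
have : v \in [set x; y] by rewrite E set22.
by rewrite !inE; do 4 (case/orP => /eqP ?); subst; auto.
Qed.

Lemma set2C (V : finType) (x y : V) : [set x; y] = [set y; x].
Proof. exact: setUC. Qed.

Section Forests.
Variable V : finType.
Implicit Types (F I J K T : {set {set V}}) (x y u v : V).

Definition adj F : rel V := [rel x y | [set x; y] \in F].
Definition conn F : rel V := connect (adj F).

Definition pairs : {set {set V}} := [set [set p.1; p.2] | p : V * V].

Lemma pairsP e : reflect (exists x y, e = [set x; y]) (e \in pairs).
Proof.
apply: (iffP imsetP) => [[p _ ->]|[x [y ->]]]; first by exists p.1, p.2.
by exists (x, y).
Qed.

Lemma conn_sym F x y : conn F x y = conn F y x.
Proof. by apply: (sym_connect_sym _) => u v; rewrite /adj /= set2C. Qed.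

Lemma conn0 F x : conn F x x.
Proof. exact: connect0. Qed.

Lemma conn1 F x y : [set x; y] \in F -> conn F x y.
Proof. by move=> xyF; apply: connect1. Qed.

Lemma conn_trans F y x z : conn F x y -> conn F y z -> conn F x z.
Proof. exact: connect_trans. Qed.

Lemma conn_map F J (f : V -> V) :
  (forall x y, [set x; y] \in F -> conn J (f x) (f y)) ->
  forall x y, conn F x y -> conn J (f x) (f y).
Proof. exact: connect_map. Qed.

Lemma conn_sub F J x y : F \subset J -> conn F x y -> conn J x y.
Proof.
move=> FJ; apply: (@conn_map F J id) => u v uv.
by apply: conn1; apply: (subsetP FJ).
Qed.

(** The closure relation of the matroid: F lies in the closure of J. J need be neither independent
    nor a part of F. *)
Definition spans J F := [forall x, forall y, ([set x; y] \in F) ==> conn J x y].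

Lemma spansP J F :
  reflect (forall x y, [set x; y] \in F -> conn J x y) (spans J F).
Proof.
apply: (iffP forallP) => [H x y xy|H x].
  by have /forallP/(_ y)/implyP := H x; apply.
by apply/forallP => y; apply/implyP; apply: H.
Qed.

Lemma spans_conn J F x y : spans J F -> conn F x y -> conn J x y.
Proof. by move=> /spansP H; exact: (@conn_map F J id H x y). Qed.

Lemma spans_trans J K F : spans J K -> spans K F -> spans J F.
Proof. by move=> JK /spansP KF; apply/spansP => x y /KF; apply: spans_conn. Qed.

Lemma sub_spans J K F : J \subset K -> spans J F -> spans K F.
Proof. by move=> JK /spansP H; apply/spansP => x y /H; apply: conn_sub. Qed.

Lemma spans_sub J K F : K \subset F -> spans J F -> spans J K.
Proof. by move=> /subsetP KF /spansP H; apply/spansP => x y /KF; apply: H. Qed.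

Lemma not_spansP J F :
  ~~ spans J F -> exists x y, [set x; y] \in F /\ ~~ conn J x y.
Proof.
move=> /forallPn[x /forallPn[y]]; rewrite negb_imply => /andP[? ?].
by exists x, y.
Qed.

Lemma conn_cross J K x y : conn J x y -> ~~ conn K x y ->
  exists u v, [set u; v] \in J /\ ~~ conn K u v.
Proof.
move=> Jxy nKxy; apply: not_spansP; apply: contra nKxy => KJ.
exact: spans_conn KJ Jxy.
Qed.

Lemma conn_closed F (C : {pred V}) x y :
  (forall u v, [set u; v] \in F -> u \in C -> v \in C) ->
  conn F x y -> x \in C -> y \in C.
Proof.
move=> cl xy xC; apply/negPn/negP => yC.
have [a [b [ab aC /negP[]]]] := connect_exit xy xC yC.
exact: cl ab aC.
Qed.

Lemma connU1 x y K u v : conn ([set x; y] |: K) u v ->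
  [\/ conn K u v, conn K u x /\ conn K y v | conn K u y /\ conn K x v].
Proof.
move=> /connectP[p]; elim: p u => [|z p IH] u /=.
  by move=> _ ->; constructor 1; exact: connect0.
rewrite /adj /= in_setU1 => /andP[uz zp] vl; have := IH _ zp vl => {IH zp vl}.
case/orP: uz => [/eqP/set2_inj[[-> ->]|[-> ->]]|/conn1 uz].
- by case=> [yv|[_ yv]|[_ xv]]; [constructor 2|constructor 2|constructor 1];
    rewrite ?yv ?xv ?conn0.
- by case=> [yv|[_ yv]|[_ xv]]; [constructor 3|constructor 1|constructor 3];
    rewrite ?yv ?xv ?conn0.
- case=> [zv|[zx yv]|[zy xv]].
  + by constructor 1; apply: conn_trans zv.
  + by constructor 2; split=> //; apply: conn_trans zx.
  + by constructor 3; split=> //; apply: conn_trans zy.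
Qed.

(** Every edge is a bridge of F. Loops are excluded as well, since [conn] is reflexive. Unlike the
    definition by cycles, this form passes directly through edge exchanges. *)
Definition indep F :=
  [forall x, forall y, ([set x; y] \in F) ==> ~~ conn (F :\ [set x; y]) x y].

Lemma indepP F :
  reflect (forall x y, [set x; y] \in F -> ~~ conn (F :\ [set x; y]) x y)
          (indep F).
Proof.
apply: (iffP forallP) => [H x y xy|H x].
  by have /forallP/(_ y)/implyP := H x; apply.
by apply/forallP => y; apply/implyP; apply: H.
Qed.

(** A path from x to y that avoids the edge xy closes up to a cycle; conversely, a cycle joins the
    ends of its first edge without using that edge. *)
Lemma acyclicP F : (forall x, [set x; x] \notin F) -> acyclic F <-> indep F.
Proof.
move=> nl; split=> [ac|/indepP ind [c [uc sc]]].
- apply/indepP => x y xy; apply/negP => /connectP[p0 xp0 yl0].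
  case/shortenP: xp0 yl0 => p xp up _ yl0 {p0}.
  apply: ac; exists (x :: p); split=> //=.
    case: p xp up yl0 => [|z [|? ?]] //=.
      by move=> _ _ E; move: (nl x); rewrite -{2}E xy.
    by rewrite /adj /= !inE andbT => /andP[/negP zx _] _ E; case: zx; rewrite E.
  rewrite rcons_path -yl0 /= set2C xy andbT.
  by apply: sub_path xp => a b; rewrite /adj /= !inE => /andP[].
- case: c uc sc => [|x [|y [|z p]]] //= /and3P[xn yn /andP[zn up]] _.
  case/and3P=> xy yz; set q := rcons p x => zq.
  have /negP[] := ind _ _ xy; rewrite conn_sym.
  apply: (@connect_trans _ _ z).
    apply: connect1; rewrite /adj /= !inE yz andbT; apply/eqP => E.
    move: xn; rewrite !inE !negb_or => /and3P[xy' /eqP xz _].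
    by case: (set2_inj E) => -[? ?]; subst; rewrite ?eqxx in xy'; auto.
  apply/connectP; exists q; last by rewrite last_rcons.
  (* The rest of the cycle runs from z back to x without meeting y, so it cannot use the edge xy. *)
  apply: (@sub_in_path _ (predC1 y) _ _ _ _ _ _ zq).
    move=> a b; rewrite !inE => /eqP ay /eqP bb ab; rewrite /adj /= !inE ab andbT.
    by apply/eqP => /set2_inj[[? ?]|[? ?]].
  move: xn yn; rewrite !inE !negb_or /= all_rcons /= => /and3P[xny _ _] /andP[yz' yp].
  rewrite eq_sym yz' xny /=; apply/allP => a ap /=.
  by apply: contra yp => /eqP <-.
Qed.

Lemma indep0 : indep set0.
Proof. by apply/indepP => x y; rewrite inE. Qed.

Lemma indep_sub F J : J \subset F -> indep F -> indep J.
Proof.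
move=> JF /indepP H; apply/indepP => x y xy.
apply: contra (H x y (subsetP JF _ xy)); apply: conn_sub; exact: setSD.
Qed.

Lemma indep_add F x y : indep F -> ~~ conn F x y -> indep ([set x; y] |: F).
Proof.
move=> /indepP H nxy; apply/indepP => u v.
have xyF : [set x; y] \notin F by apply: contra nxy; apply: conn1.
rewrite in_setU1; case: eqP => [E _|/eqP ne /= uvF].
  rewrite E setU1K //; case: (set2_inj E) => -[-> ->] //.
  by rewrite conn_sym.
apply/negP; have -> : ([set x; y] |: F) :\ [set u; v] = [set x; y] |: (F :\ [set u; v]).
  by apply/setP => e; rewrite !inE; case: eqP => //= ->; rewrite (negbTE ne).
have s : F :\ [set u; v] \subset F by apply: subD1set.
case/connU1 => [|[ux yv]|[uy xv]].
- exact/negP/H.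
- case/negP: nxy; rewrite conn_sym.
  apply: conn_trans (conn_sub s yv) _; rewrite conn_sym.
  apply: conn_trans (conn1 uvF); rewrite conn_sym; exact: conn_sub ux.
- case/negP: nxy; apply: conn_trans (conn_sub s xv) _.
  rewrite conn_sym; apply: conn_trans (conn1 uvF); rewrite conn_sym.
  exact: conn_sub uy.
Qed.

Lemma indep_nconn F x y : indep F -> [set x; y] \in F ->
  ~~ conn (F :\ [set x; y]) x y.
Proof. by move=> /indepP; apply. Qed.

Lemma basis_extend J F : F \subset pairs -> J \subset F -> indep J ->
  exists T, [/\ J \subset T, T \subset F, indep T & spans T F].
Proof.
move=> Fp; have [n le] := ubnP #|F :\: J|; elim: n J le => // n IH J le JF iJ.
case: (boolP (spans J F)) => [sJ|/not_spansP[x [y [xyF nxy]]]].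
  by exists J.
have xyJ : [set x; y] \notin J by apply: contra nxy; apply: conn1.
have [|||T [JT TF iT sT]] := IH ([set x; y] |: J).
- have <- : (F :\: J) :\ [set x; y] = F :\: ([set x; y] |: J).
    by apply/setP => e; rewrite !inE negb_or andbA.
  by rewrite (cardsD1 [set x; y]) !inE xyJ xyF /= in le; exact: le.
- by rewrite subUset sub1set xyF.
- exact: indep_add.
- exists T; split=> //; apply: subset_trans JT; exact: subsetUr.
Qed.

(** Deleting an edge of I outside J splits a component of I, and some edge of J crosses the split
    because J joins the ends of the deleted edge. Exchanging the two keeps the size of I and brings
    it closer to J. *)
Lemma steinitz I J : I \subset pairs -> indep I -> spans J I -> #|I| <= #|J|.
Proof.
have [n le] := ubnP #|I :\: J|; elim: n I le => // n IH I le Ip iI sJ.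
case: (set_0Vmem (I :\: J)) => [/eqP|[e]].
  by rewrite setD_eq0; apply: subset_leq_card.
rewrite inE => /andP[eJ eI]; have /pairsP[x [y Ee]] := subsetP Ip _ eI.
subst e; have nxy := indep_nconn iI eI.
have [u [v [uvJ nuv]]] := conn_cross (elimT (spansP _ _) sJ _ _ eI) nxy.
have uvI : [set u; v] \notin I :\ [set x; y] by apply: contra nuv; apply: conn1.
have <- : #|[set u; v] |: (I :\ [set x; y])| = #|I|.
  by rewrite cardsU1 uvI (cardsD1 [set x; y] I) eI.
apply: IH.
- have -> : ([set u; v] |: I :\ [set x; y]) :\: J = (I :\: J) :\ [set x; y].
    apply/setP => e; rewrite !inE; case: eqP => [->|_] /=; last by rewrite andbCA.
    by rewrite uvJ /= andbF.
  by rewrite (cardsD1 [set x; y]) !inE eJ eI /= in le; exact: le.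
- rewrite subUset sub1set; apply/andP; split; first by apply/pairsP; exists u, v.
  by apply: subset_trans Ip; apply: subD1set.
- by apply: indep_add nuv; apply: indep_sub iI; apply: subD1set.
- apply/spansP => a b; rewrite in_setU1 => /orP[/eqP ab|].
    by apply: conn1; rewrite ab.
  by rewrite inE => /andP[_]; apply/spansP.
Qed.

End Forests.

(** * Facets *)

Section SpanningForests.
Variables (V : finType) (g : rel V).
Hypotheses (gsym : symmetric g) (girr : irreflexive g).
Implicit Types (F I J K T : {set {set V}}) (x y u v : V).

Lemma edgesP e : reflect (exists x y, e = [set x; y] /\ g x y) (e \in edges g).
Proof.
apply: (iffP imsetP) => [[p /= pg ->]|[x [y [-> xy]]]]; first by exists p.1, p.2.
by exists (x, y).
Qed.

Lemma edgeE x y : ([set x; y] \in edges g) = g x y.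
Proof using gsym.
apply/edgesP/idP => [[u [v [/set2_inj[[-> ->]|[-> ->]] //]]]|xy].
  by rewrite gsym.
by exists x, y.
Qed.

Lemma edges_pairs : edges g \subset pairs V.
Proof. by apply/subsetP => e /edgesP[x [y [-> _]]]; apply/pairsP; exists x, y. Qed.

Definition sf T := [&& T \subset edges g, indep T & spans T (edges g)].

Lemma sfP T : reflect (spanning_forest g T) (sf T).
Proof using gsym girr.
have nl J : J \subset edges g -> forall x, [set x; x] \notin J.
  by move=> JE x; apply/negP => /(subsetP JE); rewrite edgeE girr.
apply: (iffP and3P) => [[TE iT /spansP sT]|[TE aT mT]].
  split=> //; first by apply/acyclicP => //; apply: nl.
  move=> e eE eT; have /edgesP[x [y [exy _]]] := eE; subst e.
  have sE : [set x; y] |: T \subset edges g by rewrite subUset sub1set eE.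
  move/(acyclicP (nl _ sE))/indep_nconn => /(_ _ _ (setU11 _ _)).
  by rewrite setU1K // sT.
have iT : indep T by apply/acyclicP => //; apply: nl.
split=> //; apply/spansP => x y xyE; apply/negPn/negP => nxy.
have xyT : [set x; y] \notin T by apply: contra nxy; apply: conn1.
case: (mT _ xyE xyT); apply/acyclicP; last exact: indep_add.
by apply: nl; rewrite subUset sub1set xyE.
Qed.

Lemma sf_sub T : sf T -> T \subset edges g.
Proof. by case/and3P. Qed.

Lemma sf_indep T : sf T -> indep T.
Proof. by case/and3P. Qed.

Lemma sf_spans T : sf T -> spans T (edges g).
Proof. by case/and3P. Qed.

Lemma steinitz_edges I J : I \subset edges g -> indep I -> spans J I -> #|I| <= #|J|.
Proof. by move=> IE; apply: steinitz; apply: subset_trans IE edges_pairs. Qed.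

Lemma sf_ge T J : sf T -> J \subset edges g -> indep J -> #|J| <= #|T|.
Proof.
move=> sT JE iJ; apply: steinitz_edges => //.
exact: spans_sub JE (sf_spans sT).
Qed.

Lemma sf_card T T' : sf T -> sf T' -> #|T| = #|T'|.
Proof.
move=> sT sT'; apply/eqP; rewrite eqn_leq.
by rewrite (sf_ge sT') ?(sf_ge sT) ?sf_sub ?sf_indep.
Qed.

Lemma sf_indep_card T J :
  sf T -> J \subset edges g -> indep J -> #|T| <= #|J| -> sf J.
Proof.
move=> sT JE iJ le; apply/and3P; split=> //; apply/spansP => x y xyE.
apply/negPn/negP => nxy.
have xyJ : [set x; y] \notin J by apply: contra nxy; apply: conn1.
have : #|[set x; y] |: J| <= #|T|.
  by apply: sf_ge => //; [rewrite subUset sub1set xyE | apply: indep_add].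
by rewrite cardsU1 xyJ add1n ltnNge le.
Qed.

Lemma sf_extend J : J \subset edges g -> indep J -> exists2 T, sf T & J \subset T.
Proof.
move=> JE iJ; have [T [JT TE iT sT]] := basis_extend edges_pairs JE iJ.
by exists T => //; apply/and3P.
Qed.

Lemma sf_spans_card T J :
  sf T -> J \subset edges g -> spans J (edges g) -> #|J| <= #|T| -> sf J.
Proof.
move=> sT JE sJ le.
have [K [_ KJ iK sK]] :=
  basis_extend (subset_trans JE edges_pairs) (sub0set J) (indep0 V).
have sfK : sf K by apply/and3P; split=> //; [apply: subset_trans KJ JE | apply: spans_trans sK sJ].
have /eqP <- // : K == J by rewrite eqEcard KJ (sf_card sfK sT).
Qed.

Lemma sf_swap T x y u v : sf T -> [set x; y] \in T -> g u v ->
  ~~ conn (T :\ [set x; y]) u v -> sf ([set u; v] |: T :\ [set x; y]).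
Proof using gsym.
move=> sT xyT uv nuv.
have uvT : [set u; v] \notin T :\ [set x; y] by apply: contra nuv; apply: conn1.
have DT := subD1set T [set x; y].
apply: (sf_indep_card sT).
- by rewrite subUset sub1set edgeE uv (subset_trans DT (sf_sub sT)).
- exact: indep_add (indep_sub DT (sf_indep sT)) nuv.
- by rewrite cardsU1 uvT (cardsD1 [set x; y] T) xyT.
Qed.

End SpanningForests.

(** * Facet-defining functions compared on spanning forests *)

Section Facets.
Local Open Scope ring_scope.
Variables (R : realFieldType) (V : finType) (g : rel V).
Hypotheses (gsym : symmetric g) (girr : irreflexive g).
Implicit Types (F I J K T : {set {set V}}) (x y u v : V).
Implicit Types (c : R) (a : {set V} -> R).
Local Notation sf := (sf g).
Local Notation sfP := (sfP gsym girr _).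
Local Notation nonneg := (nonneg_on_base g).

Lemma aff_sub c a c' a' (t : R) T :
  aff_eval (c - t * c') (fun e => a e - t * a' e) T =
  aff_eval c a T - t * aff_eval c' a' T.
Proof. by rewrite /aff_eval sumrB -mulr_sumr; lra. Qed.

Lemma aff_count c (d : R) F T :
  aff_eval c (fun e => d * (e \in F)%:R) T = c + d * #|T :&: F|%:R.
Proof.
rewrite /aff_eval -mulr_sumr -natr_sum -big_mkcondr /= sum1dep_card.
by congr (_ + _ * (_%:R)); apply: eq_card => e; rewrite !inE.
Qed.

Lemma aff_swap c a T e f : f \in T -> e \notin T ->
  aff_eval c a (e |: T :\ f) = aff_eval c a T + a e - a f.
Proof.
move=> fT eT; rewrite /aff_eval big_setU1 ?(big_setD1 f fT) /=; last first.
  by rewrite inE (negbTE eT) andbF.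
lra.
Qed.

Lemma nonnegP c a : nonneg c a <-> forall T, sf T -> 0 <= aff_eval c a T.
Proof using gsym girr.
by split=> H T /sfP sT; apply: H.
Qed.

(** t is the largest multiple of the second function that can be subtracted from the first without
    losing nonnegativity; T2 attains it. *)
Lemma min_ratio c a c' a' T1 :
  nonneg c a -> nonneg c' a' -> sf T1 -> aff_eval c' a' T1 != 0 ->
  exists t T2, [/\ sf T2, aff_eval c' a' T2 != 0,
    aff_eval c a T2 = t * aff_eval c' a' T2 &
    forall T, sf T -> t * aff_eval c' a' T <= aff_eval c a T].
Proof using gsym girr.
move=> /nonnegP nn /nonnegP nn' s1 v1.
pose P T := sf T && (aff_eval c' a' T != 0).
pose r T := aff_eval c a T / aff_eval c' a' T.
have P1 : P T1 by rewrite /P s1.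
case: (@arg_minP _ R _ T1 P r P1) => T2 /andP[s2 v2] min.
exists (r T2), T2; split=> //; first by rewrite divfK.
move=> T sT; have [->|vT] := eqVneq (aff_eval c' a' T) 0.
  by rewrite mulr0 nn.
have gt0 : 0 < aff_eval c' a' T by rewrite lt_def vT nn'.
by rewrite -ler_pdivlMr //; apply: min; rewrite /P sT.
Qed.

(** Subtracting the largest admissible multiple leaves a nonnegative function that vanishes on the
    face and also at T2, which is off the face. By maximality of the face the difference vanishes on
    every spanning forest. *)
Lemma facet_prop c a c' a' T1 : facet_defining g c a -> nonneg c' a' ->
  (forall T, sf T -> aff_eval c a T = 0 -> aff_eval c' a' T = 0) ->
  sf T1 -> aff_eval c' a' T1 != 0 ->
  exists t, forall T, sf T -> aff_eval c a T = t * aff_eval c' a' T.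
Proof using gsym girr.
move=> [nn _ max] nn' Z s1 v1.
have [t [T2 [s2 v2 E2 le]]] := min_ratio nn nn' s1 v1.
exists t => T sT.
have [||z|z] := max (c - t * c') (fun e => a e - t * a' e).
- by apply/nonnegP => T' s'; rewrite aff_sub subr_ge0 le.
- by move=> T' /sfP s' z; rewrite aff_sub z Z ?mulr0 ?subr0 //.
- case/eqP: v2; apply: (Z) => //; apply: z; first exact/sfP.
  by rewrite aff_sub E2 subrr.
- by apply/eqP; rewrite -subr_eq0 -aff_sub; apply/eqP/z/sfP.
Qed.

(* A non-facet is decomposed as t l' + (l - t l') with both parts vanishing on
   strictly more points, one of them not vanishing at T1. *)
Lemma facet_exists c a T1 : nonneg c a -> sf T1 -> aff_eval c a T1 != 0 ->
  exists c' a', [/\ facet_defining g c' a', aff_eval c' a' T1 != 0 &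
    forall T, sf T -> aff_eval c a T = 0 -> aff_eval c' a' T = 0].
Proof using gsym girr.
pose supp c a := [set T | sf T && (aff_eval c a T != 0)].
have [n le] := ubnP #|supp c a|.
elim: n c a le => // n IH c a le nn s1 v1.
case: (classic (facet_defining g c a)) => [fa|nfa]; first by exists c, a.
have [c' [a' [nn' Z [T3 [s3 v3 w3]] [T4 s4 v4]]]] : exists c' a',
  [/\ nonneg c' a',
      forall T, sf T -> aff_eval c a T = 0 -> aff_eval c' a' T = 0,
      exists T3, [/\ sf T3, aff_eval c a T3 != 0 & aff_eval c' a' T3 = 0] &
      exists2 T4, sf T4 & aff_eval c' a' T4 != 0].
  apply: NNPP => no; apply: nfa; split=> //; first by exists T1; split=> //; apply/sfP.
  move=> c' a' nn' Z; apply: NNPP => /not_or_and[n1 n2].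
  apply: no; exists c', a'; split=> //.
  - by move=> T sT; apply: Z; apply/sfP.
  - apply: NNPP => n3; apply: n1 => T /sfP sT v; apply/eqP/negPn/negP => v'.
    by apply: n3; exists T.
  - apply: NNPP => n3; apply: n2 => T /sfP sT; apply/eqP/negPn/negP => v'.
    by apply: n3; exists T.
have reduce (d : R) (b : {set V} -> R) : nonneg d b ->
    (forall T, sf T -> aff_eval c a T = 0 -> aff_eval d b T = 0) ->
    (exists T, [/\ sf T, aff_eval c a T != 0 & aff_eval d b T = 0]) ->
    aff_eval d b T1 != 0 ->
    exists c' a', [/\ facet_defining g c' a', aff_eval c' a' T1 != 0 &
      forall T, sf T -> aff_eval c a T = 0 -> aff_eval c' a' T = 0].
  move=> nnd Zd [T [sT vT wT]] d1.
  have [|c2 [a2 [f2 v2 Z2]]] := IH d b _ nnd s1 d1.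
    apply: leq_trans (proper_card _) _; last by rewrite -ltnS; exact: le.
    apply/properP; split.
      apply/subsetP => T'; rewrite !inE => /andP[s' /=]; rewrite s'.
      by apply: contra => /eqP z; apply/eqP/Zd.
    by exists T; rewrite !inE sT ?vT // wT eqxx.
  by exists c2, a2; split=> // T' s' z; apply: Z2 => //; apply: Zd.
have [v'|v'] := eqVneq (aff_eval c' a' T1) 0; last first.
  by apply: (reduce c' a') => //; exists T3.
have [t [T2 [s2 v2 E2 lt]]] := min_ratio nn nn' s4 v4.
apply: (reduce (c - t * c') (fun e => a e - t * a' e)).
- by apply/nonnegP => T' s'; rewrite aff_sub subr_ge0 lt.
- by move=> T sT z; rewrite aff_sub z Z // mulr0 subr0.
- exists T2; split=> //; last by rewrite aff_sub E2 subrr.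
  by apply: contra v2 => /eqP z; apply/eqP; apply: Z.
- by rewrite aff_sub v' mulr0 subr0.
Qed.

End Facets.

(** * Contracting biconnected graphs *)

Section InducedConnectivity.
Variable V : finType.
Implicit Types (g : rel V) (S W : {set V}).

Definition iconn g W : rel V :=
  connect [rel a b | [&& g a b, a \in W & b \in W]].

Lemma iconn_sym g W : symmetric g -> symmetric (iconn g W).
Proof.
move=> gs; apply: sym_connect_sym => x y /=.
by rewrite gs; congr (_ && _); rewrite andbC.
Qed.

Lemma iconn_in g W x y : iconn g W x y -> x \in W -> y \in W.
Proof.
move=> xy xW; apply/negPn/negP => yW.
by have [a [b [/and3P[_ _ bW] _ /negP]]] := connect_exit xy xW yW.
Qed.

Lemma iconn_exit g W (C : {pred V}) x y :
  iconn g W x y -> x \in C -> y \notin C ->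
  exists a b, [/\ g a b, a \in W, b \in W, a \in C & b \notin C].
Proof.
move=> xy xC yC.
by have [a [b [/and3P[? ? ?] ? ?]]] := connect_exit xy xC yC; exists a, b.
Qed.

Lemma iconn1 g W x y : g x y -> x \in W -> y \in W -> iconn g W x y.
Proof. by move=> xy xW yW; apply: connect1; rewrite /= xy xW. Qed.

Lemma iconn_step g W x y z :
  iconn g W x y -> g y z -> y \in W -> z \in W -> iconn g W x z.
Proof. by move=> xy yz yW zW; apply: connect_trans xy (iconn1 yz yW zW). Qed.

Lemma connected_inP g W : symmetric g -> ~ connected_in g W ->
  forall x, x \in W -> exists2 y, y \in W & ~~ iconn g W x y.
Proof.
move=> gs nc x xW; apply: NNPP => no; apply: nc => a b aW bW.
have H z : z \in W -> iconn g W x z.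
  by move=> zW; apply/negPn/negP => n; apply: no; exists z.
by apply: (@connect_trans _ _ x); [rewrite -/(iconn g W a x) iconn_sym //|]; apply: H.
Qed.

Lemma iconn_map (U : finType) g W (g' : rel U) (W' : {set U}) (f : V -> U) :
  (forall x y, g x y -> x \in W -> y \in W ->
     f x = f y \/ [/\ g' (f x) (f y), f x \in W' & f y \in W']) ->
  forall x y, iconn g W x y ->
  connect [rel a b | [&& g' a b, a \in W' & b \in W']] (f x) (f y).
Proof.
move=> H; apply: connect_map => x y /= /and3P[xy xW yW].
case: (H x y xy xW yW) => [->|[h1 h2 h3]]; first exact: connect0.
by apply: connect1; rewrite /= h1 h2.
Qed.

(** Biconnectedness of an induced subgraph, on a fixed vertex type, so that contraction only shrinks
    S. *)
Definition bic_in g S :=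
  [/\ 1 < #|S|, connected_in g S & forall v, connected_in g (S :\ v)].

(* Among the pairs (v, x) with v a neighbour of u and x in a component of
   S - {u, v}, take the smallest component: u has a neighbour a inside it, and
   S - {u, a} has a component strictly inside it. *)
Lemma contractible_edge g S u : symmetric g -> irreflexive g -> bic_in g S ->
  u \in S -> exists v, [/\ v \in S, g u v & connected_in g (S :\ u :\ v)].
Proof.
move=> gs gi [S2 cS cSv] uS; apply: NNPP => no.
have nc v : v \in S -> g u v -> ~ connected_in g (S :\ u :\ v).
  by move=> vS uv c; apply: no; exists v.
have ngt v : g u v -> v != u by apply: contraL => /eqP ->; rewrite gi.
have small n : forall v x, v \in S -> g u v -> x \in S :\ u :\ v ->
    #|[set y | iconn g (S :\ u :\ v) x y]| < n -> False.
  elim: n => // n IH v x vS uv xW le.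
  set W := S :\ u :\ v in xW le; set C := [set y | _] in le.
  have CP y : (y \in C) = iconn g W x y by rewrite inE.
  have xC : x \in C by rewrite CP; apply: connect0.
  have CW y : y \in C -> y \in W by rewrite CP => /iconn_in; apply.
  have uC : u \notin C by apply/negP => /CW; rewrite !inE eqxx andbF.
  have vu := ngt _ uv.
  have WE y : (y \in W) = [&& y != v, y != u & y \in S] by rewrite !inE.
  (* Since S - v is connected, C can be left there, and only towards u. This yields a neighbour a of
     u inside C, which takes the place of v. *)
  have xu : iconn g (S :\ v) x u.
    apply: cSv; first by move: xW; rewrite !inE => /and3P[-> _ ->].
    by rewrite !inE uS eq_sym vu.
  have [a [b [ab aSv bSv aC bC]]] := iconn_exit xu xC uC.
  have bu : b = u.
    apply/eqP/negPn/negP => bu; case/negP: bC; rewrite CP.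
    apply: (iconn_step (y := a)) => //; first by rewrite -CP.
      exact: CW.
    by move: bSv; rewrite WE !inE bu => /andP[-> ->].
  subst b; have ua : g u a by rewrite gs.
  have aS : a \in S by move: aSv; rewrite inE => /andP[].
  have av : a != v by move: aSv; rewrite !inE => /andP[].
  set W' := S :\ u :\ a.
  have W'E y : (y \in W') = [&& y != a, y != u & y \in S] by rewrite !inE.
  have vW' : v \in W' by rewrite W'E eq_sym av vu vS.
  have [x' x'W' x'D] := connected_inP gs (nc _ aS ua) vW'.
  (* Any other component of S - {u, v} is adjacent to v, because S - u is connected, and does not
     contain a; it stays joined to v when a is removed instead of v. *)
  have outD y : y \in W -> y \notin C -> iconn g W' v y.
    move=> yW yC.
    have [yv yu yS] := and3P (etrans (esym (WE y)) yW).
    have yv' : iconn g (S :\ u) y v by apply: cSv; rewrite !inE ?vu ?yu.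
    have vR : v \notin iconn g W y.
      by apply/negP => /iconn_in; rewrite !WE eqxx /= yv yu yS => /(_ isT).
    have [|r [b [rb rS bS rR bR]]] := iconn_exit (C := iconn g W y) yv' _ vR.
      exact: connect0.
    have rW : r \in W := iconn_in rR yW.
    have bv : b = v.
      apply/eqP/negPn/negP => bv; case/negP: bR.
      apply: (iconn_step (y := r)) => //.
      by rewrite WE bv; move: bS; rewrite !inE.
    subst b.
    have RC z : iconn g W y z -> z != a.
      move=> yz; apply: contra yC => /eqP za; rewrite CP.
      move: aC; rewrite CP => xa; apply: connect_trans xa _.
      by rewrite -za -/(iconn g W z y) iconn_sym.
    have toW' z : iconn g W y z -> z \in W'.
      move=> yz; rewrite W'E (RC _ yz) /=.
      by have := iconn_in yz yW; rewrite WE => /and3P[_ -> ->].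
    have vr : iconn g W' v r by apply: iconn1; [rewrite gs | | exact: toW'].
    apply/negPn/negP => nvy.
    have ry : iconn g W r y by rewrite iconn_sym.
    have [||p [q [pq pW qW]]] :=
      iconn_exit (C := [pred z | iconn g W' v z && iconn g W y z]) ry.
    - by rewrite inE vr.
    - by rewrite inE (negbTE nvy).
    - rewrite !inE => /andP[vp yp] /negP[].
      have yq : iconn g W y q by apply: iconn_step yp pq pW qW.
      by rewrite yq andbT; apply: iconn_step vp pq _ _; apply: toW'.
  have [x'a x'u x'S] := and3P (etrans (esym (W'E x')) x'W').
  have inC z : z \in W' -> ~~ iconn g W' v z -> z \in C.
    move=> zW' zD; apply: contraR zD => zC; have [->|zv] := eqVneq z v.
      exact: connect0.
    apply: (outD z) => //; rewrite WE zv.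
    by move: zW'; rewrite W'E => /and3P[_ -> ->].
  (* x' is separated from v in S - {u, a}, so its component lies in C, and strictly, as it misses
     a. *)
  apply: (IH a x' aS ua x'W').
  have : [set y | iconn g W' x' y] \proper C; last first.
    by move/proper_card/leq_trans; apply; rewrite -ltnS.
  apply/properP; split; last first.
    exists a => //; rewrite inE; apply/negP => /iconn_in/(_ x'W').
    by rewrite W'E eqxx.
  apply/subsetP => z; rewrite inE => x'z; apply: inC.
    exact: iconn_in x'z x'W'.
  apply: contra x'D => vz; apply: connect_trans vz _.
  by rewrite -/(iconn g W' z x') iconn_sym.
have [y yS yu] : exists2 y, y \in S & y != u.
  have : 0 < #|S :\ u| by move: S2; rewrite (cardsD1 u S) uS.
  by case/card_gt0P => y; rewrite !inE => /andP[? ?]; exists y.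
have [||a [v [av aS vS]]] := iconn_exit (C := pred1 u) (cS u y uS yS).
- by rewrite inE.
- by rewrite inE.
- rewrite !inE => /eqP au vu; subst a.
  apply: (nc _ vS av) => x z xW _; case: (small _ v x vS av xW (ltnSn _)).
Qed.

End InducedConnectivity.

(** * Contraction to a biconnected minor on k + 1 vertices *)

Section Contraction.
Variable V : finType.
Implicit Types (g : rel V) (S W N : {set V}).

Lemma disjoint_setU1 (x : V) S W :
  x \notin W -> [disjoint S & W] -> [disjoint x |: S & W].
Proof. by move=> xW; rewrite !disjoints_subset subUset sub1set inE xW. Qed.

(* The edge uv is contracted onto v; u is kept as an unused vertex so that the
   vertex type does not change. *)
Definition contract g u v : rel V :=
  [rel x y | (x != y) && [|| g x y, (x == v) && g u y | (y == v) && g u x]].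

Lemma contract_sym g u v : symmetric g -> symmetric (contract g u v).
Proof.
move=> gs x y; rewrite /contract /= eq_sym (gs x y); congr (_ && (_ || _)).
exact: orbC.
Qed.

Lemma contract_irr g u v : irreflexive (contract g u v).
Proof. by move=> x; rewrite /contract /= eqxx. Qed.

(** Sending u to v maps paths to paths, which settles the deletion of every vertex other than v.
    Deleting v from the contracted graph removes both ends of the edge; there the connectedness of S
    - {u, v} enters. *)
Lemma contract_bic g S u v : symmetric g -> irreflexive g -> bic_in g S ->
  u \in S -> v \in S -> g u v -> 2 < #|S| -> connected_in g (S :\ u :\ v) ->
  bic_in (contract g u v) (S :\ u).
Proof.
move=> gs gi [_ cS cSv] uS vS uv S3 cuv.
have vu : v != u by apply: contraTneq uv => ->; rewrite gi.
pose f x := if x == u then v else x.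
have fE x : x != u -> f x = x by rewrite /f => /negbTE ->.
have fmap W x y : v \in W -> g x y -> x \in W -> y \in W ->
    f x = f y \/ [/\ contract g u v (f x) (f y), f x \in W :\ u & f y \in W :\ u].
  move=> vW xy xW yW; rewrite !in_setD1 /f /contract /=.
  have [xu|xu] := eqVneq x u; have [yu|yu] := eqVneq y u; first by left.
  - have [->|vy] := eqVneq v y; first by left.
    by right; rewrite eqxx -{1}xu xy /= orbT yW ?yu vu vW.
  - have [->|xv] := eqVneq x v; first by left.
    have ux : g u x by rewrite -yu gs.
    by right; rewrite eqxx ux /= !orbT xW ?xu vu vW.
  - have [->|ne] := eqVneq x y; first by left.
    by right; rewrite xy xW yW ?xu ?yu.
have cW W x y : v \in W -> connected_in g W -> x \in W :\ u -> y \in W :\ u ->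
    iconn (contract g u v) (W :\ u) x y.
  move=> vW c; rewrite !in_setD1 => /andP[xu xW] /andP[yu yW].
  rewrite -(fE x xu) -(fE y yu).
  apply: (iconn_map (g := g) (W := W)); last exact: c.
  by move=> a b; apply: fmap.
split.
- by move: S3; rewrite (cardsD1 u S) uS.
- by move=> x y; apply: cW.
move=> w; have [->|wv] := eqVneq w v.
  move=> x y xW yW.
  apply: (iconn_map (g := g) (W := S :\ u :\ v) (f := id)); last exact: cuv.
  move=> a b ab aW bW; have [->|ne] := eqVneq a b; first by left.
  by right; rewrite /contract /= ne ab.
have -> : S :\ u :\ w = S :\ w :\ u by apply/setP => z; rewrite !inE andbCA.
by move=> x y; apply: cW => //; rewrite !inE eq_sym wv.
Qed.

(** N is the set of marked vertices. Contraction stops when S has k + 1 vertices; more than k marks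
    are kept throughout, so in the end every vertex is marked and every block contains a mark. *)
Lemma marked_minor k g S N : 0 < k -> symmetric g -> irreflexive g ->
  bic_in g S -> N \subset S -> k < #|N| ->
  exists S' h (B : V -> {set V}),
    [/\ symmetric h /\ irreflexive h, bic_in h S', #|S'| = k.+1 &
     [/\ forall s, s \in S' -> B s \subset S /\ exists2 z, z \in N & z \in B s,
         forall s, s \in S' -> connected_in g (B s),
         forall s t, s \in S' -> t \in S' -> s != t -> [disjoint B s & B t] &
         forall s t, s \in S' -> t \in S' -> h s t ->
           exists x y, [/\ x \in B s, y \in B t & g x y]]].
Proof.
move=> k0; have [n le] := ubnP #|S|.
elim: n g S N le => // n IH g S N le gs gi bS NS kN.
have NS' := subset_leq_card NS.
have [S1|S1] := eqVneq #|S| k.+1.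
  have NE : N = S by apply/eqP; rewrite eqEcard NS S1.
  exists S, g, (fun s => [set s]); split=> //; split.
  - by move=> s sS; rewrite sub1set; split=> //; exists s; rewrite ?inE // NE.
  - by move=> s _ x y; rewrite !inE => /eqP -> /eqP ->; apply: connect0.
  - by move=> s t _ _ st; rewrite disjoints1 inE.
  - by move=> s t _ _ st; exists s, t; rewrite !inE.
have kS : k.+1 < #|S| by rewrite ltn_neqAle eq_sym S1 (leq_trans kN).
(* An unmarked vertex costs no mark. If all are marked, any vertex will do, since S has more than k
   + 1 of them. *)
have [u uS kNu] : exists2 u, u \in S & k < #|N :\ u|.
  have [NE|] := eqVneq N S.
    have : 0 < #|S| by apply: leq_trans kS.
    case/card_gt0P=> u uS; exists u => //.
    by move: kS; rewrite NE (cardsD1 u S) uS add1n ltnS.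
  rewrite eqEsubset NS /= => /subsetPn[u uS uN]; exists u => //.
  by move: kN; rewrite (cardsD1 u N) (negbTE uN).
have [v [vS uv cuv]] := contractible_edge gs gi bS uS.
have vu : v != u by apply: contraTneq uv => ->; rewrite gi.
have [||||||S' [h [B [hg bh hk [BS Bc Bd Be]]]]] :=
  IH (contract g u v) (S :\ u) (N :\ u).
- by move: le; rewrite (cardsD1 u S) uS.
- exact: contract_sym.
- exact: contract_irr.
- by apply: contract_bic => //; apply: leq_ltn_trans kS.
- exact: setSD.
- by [].
(* The vertex u rejoins the block of the vertex v onto which it was contracted. *)
exists S', h, (fun s => if v \in B s then u |: B s else B s); split=> //.
have BSu s x : s \in S' -> x \in B s -> x \in S /\ x != u.
  by move=> sS xB; have [/subsetP/(_ x xB)] := BS s sS; rewrite !inE => /andP[].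
split.
- move=> s sS; have [BSs [z zN zB]] := BS s sS; split.
    have BS1 : B s \subset S by apply: subset_trans BSs (subD1set _ _).
    by case: ifP => // _; rewrite subUset sub1set uS.
  exists z; first by move: zN; rewrite inE => /andP[].
  by case: ifP => // _; rewrite inE zB orbT.
- move=> s sS; set C := if _ then _ else _.
  have BC x : x \in B s -> x \in C by rewrite /C; case: ifP => // _; rewrite inE orbC => ->.
  have cB x y : x \in B s -> y \in B s -> iconn g C x y.
    move=> xB yB; apply: (connect_map (f := id) _ (Bc s sS x y xB yB)).
    move=> a b /= /and3P[/andP[_ ab] aB bB].
    case/or3P: ab => [ab1|/andP[/eqP av ub]|/andP[/eqP bw ua]].
    + by apply: iconn1; rewrite ?BC.
    + have uC : u \in C by rewrite /C -av aB setU11.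
      have au : g a u by rewrite av gs.
      by apply: (connect_trans (y := u)); apply: iconn1 => //; apply: BC.
    + have uC : u \in C by rewrite /C -bw bB setU11.
      have au : g a u by rewrite gs.
      have ub : g u b by rewrite bw.
      by apply: (connect_trans (y := u)); apply: iconn1 => //; apply: BC.
  have toB x : x \in C -> exists2 y, y \in B s & iconn g C x y.
    rewrite {1}/C; case: ifP => vB; last by move=> xB; exists x => //; apply: connect0.
    case/setU1P=> [->|xB]; last by exists x => //; apply: connect0.
    by exists v => //; apply: iconn1; rewrite /C ?vB ?setU11 // setU1r.
  move=> x y /toB[x' x'B xx'] /toB[y' y'B yy'].
  apply: connect_trans xx' (connect_trans (cB _ _ x'B y'B) _).
  by rewrite -/(iconn g C y' y) iconn_sym.
- have dis s t : s \in S' -> t \in S' -> s != t ->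
      [disjoint (if v \in B s then u |: B s else B s) & B t].
    move=> sS tS st; have d := Bd s t sS tS st.
    case: ifP => // vB; apply: disjoint_setU1 => //.
    by apply/negP => /(BSu t u tS)[_]; rewrite eqxx.
  move=> s t sS tS st; have d := dis s t sS tS st.
  case: (boolP (v \in B t)) => // vt.
  rewrite disjoint_sym; apply: disjoint_setU1; last by rewrite disjoint_sym.
  case: ifP => [vs|_].
    by move: (Bd s t sS tS st) => /disjointFr/(_ vs); rewrite vt.
  by apply/negP => /(BSu s u sS)[_]; rewrite eqxx.
- move=> s t sS tS st; have [x [y [xB yB /andP[_ xy]]]] := Be s t sS tS st.
  have BC r z : z \in B r -> z \in (if v \in B r then u |: B r else B r).
    by case: ifP => // _; rewrite inE orbC => ->.
  case/or3P: xy => [xy|/andP[/eqP xv uy]|/andP[/eqP yv ux]].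
  + by exists x, y; rewrite /= !BC.
  + by exists u, y; rewrite /= (BC _ _ yB) -xv xB setU11.
  + by exists x, u; rewrite /= (BC _ _ xB) -yv yB setU11 gs.
Qed.

Lemma minimally_biconnected_sub (h : rel V) :
  symmetric h -> irreflexive h -> biconnected h ->
  exists h', [/\ symmetric h', irreflexive h', minimally_biconnected h' & subrel h' h].
Proof.
have [n le] := ubnP #|[set p | h p.1 p.2]|.
elim: n h le => // n IH h le hs hi bh.
case: (classic (minimally_biconnected h)) => [mh|nm].
  by exists h; split=> // a b.
have [x [y [xy b]]] : exists x y, h x y /\ biconnected (delete_edge h x y).
  apply: NNPP => no; apply: nm; split=> // x y xy b; apply: no.
  by exists x, y.
have [|||h' [h's h'i mh sub]] := IH (delete_edge h x y) _ _ _ b => //.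
- rewrite -ltnS; apply: leq_trans le; rewrite ltnS; apply: proper_card.
  apply/properP; split; first by apply/subsetP => p; rewrite !inE => /andP[].
  by exists (x, y); rewrite !inE /delete_edge //= eqxx andbF.
- by move=> a b'; rewrite /delete_edge /= hs set2C.
- by move=> a; rewrite /delete_edge /= hi.
- by exists h'; split=> // a b' /sub /andP[].
Qed.

End Contraction.

(** The marks are the vertices of S with a neighbour in Q. Every block then has an edge to Q, so Q
    serves as the branch set of the apex. *)
Lemma cone_minor (V : finType) (g : rel V) k (S Q : {set V}) : 0 < k ->
  symmetric g -> irreflexive g -> bic_in g S -> connected_in g Q ->
  [disjoint S & Q] -> k < #|[set s in S | [exists z in Q, g s z]]| ->
  exists h : rel 'I_k.+1,
    [/\ symmetric h, irreflexive h, minimally_biconnected h & has_minor g (cone h)].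
Proof.
move=> k0 gs gi bS cQ dSQ; set N := [set s in S | _] => kN.
have NS : N \subset S by apply/subsetP => z; rewrite inE => /andP[].
have [S' [h [B [[hs hi] [_ ch chv] hk [BS Bc Bd Be]]]]] := marked_minor k0 gs gi bS NS kN.
pose f (i : 'I_k.+1) := enum_val (cast_ord (esym hk) i).
have fS i : f i \in S' by apply: enum_valP.
have finj : injective f.
  by move=> i j /enum_val_inj /(congr1 (@nat_of_ord _)) ij; apply: val_inj.
have s0S := fS ord0.
pose fi s := cast_ord hk (enum_rank_in s0S s).
have fK s : s \in S' -> f (fi s) = s.
  by move=> sS; rewrite /f /fi cast_ordK enum_rankK_in.
have fiK i : fi (f i) = i by apply: finj; rewrite fK.
pose h' : rel 'I_k.+1 := fun i j => h (f i) (f j).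
have bh' : biconnected h'.
  split; first by rewrite card_ord; lia.
  have tr (W : {set V}) (W' : {set 'I_k.+1}) : W \subset S' ->
      (forall i, (f i \in W) = (i \in W')) -> connected_in h W -> connected_in h' W'.
    move=> /subsetP WS WW c i j iW jW; rewrite -(fiK i) -(fiK j).
    apply: (iconn_map (g := h) (W := W)); last by apply: c; rewrite WW.
    move=> x y xy xW yW; right; rewrite /h' -!WW !fK ?WS //.
  split; first by apply: (tr S') => // i; rewrite fS inE.
  move=> v; apply: (tr (S' :\ f v)) => //; first exact: subD1set.
  by move=> i; rewrite !inE fS andbT (inj_eq finj).
have [h2 [h2s h2i mh sub]] := minimally_biconnected_sub (fun i j => hs _ _) (fun i => hi _) bh'.
exists h2; split=> //.
have Q0 i : exists x y, [/\ x \in B (f i), y \in Q & g x y].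
  have [_ [z zN zB]] := BS _ (fS i).
  by move: zN; rewrite inE => /andP[_ /existsP[y /andP[yQ zy]]]; exists z, y.
exists (fun o => if o is Some i then B (f i) else Q); split.
- case=> [i|]; apply/set0Pn; last by have [x [y [_ yQ _]]] := Q0 ord0; exists y.
  by have [x [y [xB _ _]]] := Q0 i; exists x.
- have dQ i : [disjoint B (f i) & Q].
    by have [BSi _] := BS _ (fS i); apply: disjointWl BSi dSQ.
  case=> [i|] [j|] ij;
    [|exact: dQ|by rewrite disjoint_sym dQ|by rewrite eqxx in ij].
  by apply: Bd => //; apply: contra ij => /eqP/finj ->.
- by case=> [i|] //; apply: Bc.
- case=> [i|] [j|] //= hij.
  + by apply: Be => //; apply: sub hij.
  + by have [x [y [? ? xy]]] := Q0 j; exists y, x; rewrite gs.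
Qed.

(** * From facets to cone minors *)

Lemma component_connected (V : finType) (g : rel V) W y : symmetric g ->
  connected_in g [set z | iconn g W y z].
Proof.
move=> gs; set C := [set z | _].
have yC : y \in C by rewrite inE; apply: connect0.
have H z : z \in C -> iconn g C y z.
  rewrite inE => yz; apply/negPn/negP => nyz.
  have [||a [b [ab aW bW ya nyb]]] := iconn_exit (C := iconn g C y) yz.
  - exact: connect0.
  - by [].
  have aC : a \in C := iconn_in ya yC.
  have bC : b \in C by move: aC; rewrite !inE => h; apply: iconn_step h ab aW bW.
  by case/negP: nyb; apply: iconn_step ya ab aC bC.
move=> a b aC bC; apply: (@connect_trans _ _ y); last exact: H.
by rewrite -/(iconn g C a y) iconn_sym // H.
Qed.

Lemma component_sub (V : finType) (g : rel V) (W : {set V}) y :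
  y \in W -> [set z | iconn g W y z] \subset W.
Proof. by move=> yW; apply/subsetP => z; rewrite inE => /iconn_in; apply. Qed.

(** Let K grow inside T edge by edge. The edge whose addition first joins p and q lies on the unique
    path of T between them, so T loses that connection without it. *)
Lemma indep_remove_cut (V : finType) (T K : {set {set V}}) p q :
  T \subset pairs V -> indep T -> K \subset T -> conn T p q -> ~~ conn K p q ->
  exists x y, [/\ [set x; y] \in T, [set x; y] \notin K &
                  ~~ conn (T :\ [set x; y]) p q].
Proof.
move=> Tp iT; have [n le] := ubnP #|T :\: K|.
elim: n K le => // n IH K le KT Tpq nK.
have [e] : exists e, e \in T :\: K.
  by apply/set0Pn; apply: contra nK; rewrite setD_eq0 => TK; apply: conn_sub Tpq.
rewrite inE => /andP[eK eT]; have /pairsP[x [y Ee]] := subsetP Tp _ eT; subst e.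
case: (boolP (conn ([set x; y] |: K) p q)) => [c|nc].
  exists x, y; split=> //; apply/negP => c'; case/negP: (indep_nconn iT eT).
  have KT' : K \subset T :\ [set x; y] by rewrite subsetD1 KT.
  case: (connU1 c) => [|[px yq]|[py xq]]; first by rewrite (negbTE nK).
  - rewrite conn_sym; apply: conn_trans (conn_sub KT' yq) _.
    by rewrite conn_sym; apply: conn_trans c'; rewrite conn_sym; apply: conn_sub px.
  - apply: conn_trans (conn_sub KT' xq) _; rewrite conn_sym.
    by apply: conn_trans c'; rewrite conn_sym; apply: conn_sub py.
have [||x' [y' [h1 h2 h3]]] := IH ([set x; y] |: K) _ _ Tpq nc.
- have <- : (T :\: K) :\ [set x; y] = T :\: ([set x; y] |: K).
    by apply/setP => e; rewrite !inE negb_or andbA.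
  by rewrite (cardsD1 [set x; y]) !inE eK eT in le.
- by rewrite subUset sub1set eT.
- by exists x', y'; split=> //; apply: contra h2 => h; rewrite inE h orbT.
Qed.

Lemma conn_restrict (V : finType) (J : {set {set V}}) (C : {set V}) x y :
  (forall u v, [set u; v] \in J -> u \in C -> v \in C) ->
  conn J x y -> x \in C -> conn [set e in J | e \subset C] x y.
Proof.
move=> cl /connectP[p]; elim: p x => [|z p IH] x /=.
  by move=> _ -> _; apply: conn0.
rewrite {1}/adj /= => /andP[xz zp] yl xC; have zC := cl _ _ xz xC.
apply: conn_trans (IH z zp yl zC); apply: conn1.
by rewrite inE xz subUset !sub1set xC.
Qed.

Section LevelToMinor.
Variables (V : finType) (g : rel V).
Hypotheses (gsym : symmetric g) (girr : irreflexive g).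
Implicit Types (F I J K T : {set {set V}}) (x y u v : V) (S : {set V}).
Local Notation sf := (sf g).

Lemma edge_neq x y : g x y -> x != y.
Proof. by apply: contraTneq => ->; rewrite girr. Qed.

(** The case k = 1, where the cone over K_2 is a triangle. The edge uw closes a cycle with T; the
    rest of that cycle lies in one component of G - {u, w}, which is adjacent to both ends and
    becomes the apex. *)
Lemma nonbridge_cone T u w : sf T -> g u w -> [set u; w] \notin T ->
  exists h : rel 'I_2,
    [/\ symmetric h, irreflexive h, minimally_biconnected h & has_minor g (cone h)].
Proof.
move=> sT uw uwT; have nuw := edge_neq uw.
set W := ~: [set u; w].
have WE z : (z \in W) = (z != u) && (z != w) by rewrite !inE negb_or.
have Tc : conn T w u by rewrite conn_sym; apply: (elimT (spansP _ _) (sf_spans sT)); rewrite edgeE.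
(* C consists of w and the components of G - {u, w} adjacent to w. The path of T from w to u can
   leave C only from such a component, directly to u. *)
pose C := [pred z | (z != u) &&
  ((z == w) || [exists y, [&& g w y, y \in W & iconn g W y z]])].
have [||a [b [ab aC bC]]] := connect_exit (C := C) Tc.
- by rewrite inE eq_sym nuw eqxx.
- by rewrite inE eqxx.
have gab : g a b by rewrite -(edgeE gsym); apply: (subsetP (sf_sub sT)).
have nab := edge_neq gab.
have [aw|aw] := eqVneq a w.
  subst a; case/negP: bC; rewrite inE.
  have bu : b != u by apply: contra uwT => /eqP <-; rewrite set2C.
  rewrite bu /=; apply/orP; right; apply/existsP; exists b.
  by rewrite gab WE bu eq_sym nab; apply: connect0.
move: aC; rewrite inE (negbTE aw) /= => /andP[au /existsP[y /and3P[wy yW ya]]].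
have aW : a \in W by rewrite WE au.
have bw : b != w.
  apply: contra bC => /eqP ->; rewrite inE eqxx andbT eq_sym //.
have bu : b = u.
  apply/eqP/negPn/negP => bu; case/negP: bC; rewrite inE bu.
  apply/orP; right; apply/existsP; exists y; rewrite wy yW /=.
  by apply: iconn_step ya gab aW _; rewrite WE bu.
subst b; pose Q := [set z | iconn g W y z].
have c1 v z : connected_in g ([set v; z] :\ v).
  move=> s t; rewrite !inE => /andP[/negbTE sv]; rewrite sv /= => /eqP ->.
  by move=> /andP[/negbTE tv]; rewrite tv /= => /eqP ->; apply: connect0.
have c2 : connected_in g [set u; w].
  have H : iconn g [set u; w] u w by apply: iconn1; rewrite ?set21 ?set22.
  move=> s t /set2P[] -> /set2P[] ->; try exact: connect0.
    exact: H.
  by rewrite -/(iconn g [set u; w] w u) iconn_sym.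
apply: (@cone_minor V g 1 [set u; w] Q) => //.
- split; rewrite ?cards2 ?nuw // => v.
  have [->|vu] := eqVneq v u; first exact: c1.
  have [->|vw] := eqVneq v w; first by rewrite set2C; apply: c1.
  have -> // : [set u; w] :\ v = [set u; w].
  by apply/setDidPl; rewrite disjoint_sym disjoints1 !inE negb_or vu vw.
- exact: component_connected.
- by rewrite disjoint_sym disjoints_subset; apply: component_sub.
- have -> : [set s in [set u; w] | [exists z in Q, g s z]] = [set u; w].
    apply/setP => s; rewrite inE; apply: andb_idr => /set2P[] ->; apply/existsP.
      by exists a; rewrite inE ya gsym.
    by exists y; rewrite inE wy andbT; apply: connect0.
  by rewrite cards2 nuw.
Qed.

End LevelToMinor.

(** * Vertex sets whose rank inequality is tight on a facet *)

Section FacetStructure.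
Local Open Scope ring_scope.
Variables (R : realFieldType) (V : finType) (g : rel V).
Hypotheses (gsym : symmetric g) (girr : irreflexive g).
Variables (c : R) (a : {set V} -> R).
Hypothesis fac : facet_defining g c a.
Implicit Types (F I J K T : {set {set V}}) (x y u v : V) (S : {set V}).
Local Notation sf := (sf g).
Local Notation sfP := (sfP gsym girr _).
Local Notation ell := (aff_eval c a).

Lemma facet_ge0 T : sf T -> 0 <= ell T.
Proof using gsym girr fac.
by case: fac => + _ _; move/(nonnegP gsym girr c a)=> h; apply: h.
Qed.

(** If the function never vanishes, subtract its minimum, found as a ratio to the constant 1. The
    result has a zero and contains the empty face, so maximality forces it to vanish everywhere. *)
Lemma facet_zero :
  (exists2 T0, sf T0 & ell T0 = 0) \/ (exists r, forall T, sf T -> ell T = r).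
Proof using gsym girr fac.
apply: NNPP => /not_or_and[nz nc]; have [nnf [T1 [/sfP s1 v1]] max] := fac.
have E1 T : aff_eval (1 : R) (fun=> 0) T = 1 by rewrite /aff_eval big1 // addr0.
have [t [T2 [s2 _ E2 le]]] : exists t T2, [/\ sf T2, aff_eval (1 : R) (fun=> 0) T2 != 0,
    ell T2 = t * aff_eval 1 (fun=> 0) T2 &
    forall T, sf T -> t * aff_eval 1 (fun=> 0) T <= ell T].
  apply: (@min_ratio R V g gsym girr c a 1 (fun=> 0) T1) => //.
    by apply/(nonnegP gsym girr) => T _; rewrite E1 ler01.
  by rewrite E1 oner_eq0.
rewrite E1 mulr1 in E2.
have Ev T : aff_eval (c - t * 1) (fun e => a e - t * 0) T = ell T - t.
  by rewrite (aff_sub c a 1 (fun=> 0)) E1 mulr1.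
case: (max (c - t * 1) (fun e => a e - t * 0)).
- by apply/(nonnegP gsym girr) => T sT; rewrite Ev subr_ge0 -(mulr1 t) -(E1 T) le.
- by move=> T /sfP sT z; case: nz; exists T.
- move=> h; apply: nz; exists T2 => //; apply: h; first exact/sfP.
  by rewrite Ev E2 subrr.
- move=> h; apply: nc; exists t => T sT; apply/eqP; rewrite -subr_eq0 -Ev.
  by apply/eqP/h/sfP.
Qed.

(** Single exchanges lead from T0 to a forest off the face, so some exchange leaves the face. *)
Lemma facet_adjacent T0 : sf T0 -> ell T0 = 0 ->
  exists T x y u v, [/\ sf T /\ ell T = 0, [set x; y] \in T, g u v /\ [set u; v] \notin T,
    sf ([set u; v] |: T :\ [set x; y]) & ell ([set u; v] |: T :\ [set x; y]) != 0].
Proof using gsym girr fac.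
have [_ [T1 [/sfP s1 v1]] _] := fac.
have [n le] := ubnP #|T0 :\: T1|; elim: n T0 le => // n IH T le sT zT.
have [e] : exists e, e \in T :\: T1.
  apply/set0Pn; apply: contra v1; rewrite setD_eq0 => TT.
  have /eqP <- : T == T1 by rewrite eqEcard TT (sf_card s1 sT) leqnn.
  by rewrite zT.
rewrite inE => /andP[eT1 eT]; have /edgesP[x [y [Ee xy]]] := subsetP (sf_sub sT) _ eT.
subst e; have nxy := indep_nconn (sf_indep sT) eT.
have [u [v [uvT1 nuv]]] : exists u v, [set u; v] \in T1 /\ ~~ conn (T :\ [set x; y]) u v.
  apply: conn_cross nxy; apply: (elimT (spansP _ _) (sf_spans s1)).
  by rewrite edgeE.
have guv : g u v by rewrite -(edgeE gsym) (subsetP (sf_sub s1)).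
have uvT : [set u; v] \notin T.
  apply: contra nuv => uvT; apply: conn1; rewrite !inE uvT andbT.
  by apply: contra eT1 => /eqP <-.
have sT' := sf_swap gsym sT eT guv nuv.
have [z|nz] := eqVneq (ell ([set u; v] |: T :\ [set x; y])) 0; last first.
  by exists T, x, y, u, v.
apply: (IH _ _ sT' z).
have -> : ([set u; v] |: T :\ [set x; y]) :\: T1 = (T :\: T1) :\ [set x; y].
  apply/setP => e; rewrite !inE; case: eqP => [->|_] /=; last by rewrite andbCA.
  by rewrite uvT1 /= andbF.
by rewrite (cardsD1 [set x; y]) !inE eT1 eT in le.
Qed.

(** Zeros are forests of minimum weight. If an edge pq of weight at most t were not spanned, it
    could replace an edge of weight above t on the path of T from p to q, and the value would become
    negative. *)
Lemma face_spans_threshold T (t : R) : sf T -> ell T = 0 ->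
  spans (T :&: [set e in edges g | a e <= t]) [set e in edges g | a e <= t].
Proof using gsym girr fac.
move=> sT zT; set F := [set e in _ | _]; apply/spansP => p q pqF.
apply/negPn/negP => npq.
have := pqF; rewrite inE edgeE // => /andP[gpq apq].
have Tpq : conn T p q by apply: (elimT (spansP _ _) (sf_spans sT)); rewrite edgeE.
have Tp := subset_trans (sf_sub sT) (edges_pairs g).
have [x [y [xyT xyF nc]]] := indep_remove_cut Tp (sf_indep sT) (subsetIl _ _) Tpq npq.
have pqT : [set p; q] \notin T.
  by apply: contra npq => pqT; apply: conn1; rewrite inE pqT.
have := facet_ge0 (sf_swap gsym sT xyT gpq nc); rewrite aff_swap // zT.
move: xyF; rewrite !inE xyT (subsetP (sf_sub sT)) //= -ltNge; lra.
Qed.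

Definition induced S : {set {set V}} := [set e in edges g | e \subset S].

Lemma induced2 S x y : ([set x; y] \in induced S) = [&& g x y, x \in S & y \in S].
Proof using gsym. by rewrite inE edgeE // subUset !sub1set. Qed.

(** The rank inequality of S is tight on the whole face but not at every spanning forest, expressed
    by connectedness instead of by counting edges. *)
Definition face_connects S :=
  (forall T, sf T -> ell T = 0 ->
     forall p q, p \in S -> q \in S -> conn (T :&: induced S) p q) /\
  exists T p q, [/\ sf T, p \in S, q \in S & ~~ conn (T :&: induced S) p q].

(* The facet lies on the face where an edge outside F, but with connected ends
   in F, vanishes, where F consists of the edges of weight at most that of xy;
   otherwise F is a flat, and S is the component of F containing xy. *)
Lemma facet_cases T0 : sf T0 -> ell T0 = 0 ->
  (exists r1 r2, forall T, sf T -> ell T = r1 \/ ell T = r2) \/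
  (exists S, face_connects S).
Proof using gsym girr fac.
move=> s0 z0; have [T [x [y [u [v [[sT zT] xyT [guv uvT] sT' nz]]]]]] := facet_adjacent s0 z0.
have lt : a [set x; y] < a [set u; v].
  by have := facet_ge0 sT'; move: nz; rewrite aff_swap // zT lt_def => ??; lra.
set F := [set e in edges g | a e <= a [set x; y]].
have xyE : [set x; y] \in edges g by apply: (subsetP (sf_sub sT)).
have xyF : [set x; y] \in F by rewrite inE xyE lexx.
case: (classic (exists p q, [/\ g p q, conn F p q & [set p; q] \notin F])).
  move=> [p [q [gpq Fpq pqF]]]; left.
  have Ev T1 : aff_eval 0 (fun e => 1 * (e \in [set [set p; q]])%:R) T1 = ([set p; q] \in T1)%:R :> R.
    rewrite aff_count add0r mul1r; congr _%:R; case: (boolP (_ \in T1)) => h.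
      by have /setIidPr -> : [set [set p; q]] \subset T1; rewrite ?sub1set ?cards1.
    by apply/eqP; rewrite cards_eq0 setI_eq0 disjoint_sym disjoints1.
  have [T1 s1 pqT1] : exists2 T1, sf T1 & [set [set p; q]] \subset T1.
    apply: sf_extend; first by rewrite sub1set edgeE.
    rewrite -(setU0 [set _]); apply: indep_add; first exact: indep0.
    apply/negP => h; have /= : q \in pred1 p.
      by apply: conn_closed h _ => [? ?|]; rewrite inE.
    by rewrite inE => /eqP E; rewrite E girr in gpq.
  have [||||t Et] := @facet_prop R V g gsym girr c a 0 (fun e => 1 * (e \in [set [set p; q]])%:R) T1 fac.
  - by apply/(nonnegP gsym girr) => T2 _; rewrite Ev ler0n.
  (* On the face F-edges of the forest already join p and q, so pq, which is not in F, would close a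
     cycle. *)
  - move=> T2 s2 z2; rewrite Ev; case: (boolP (_ \in T2)) => // pqT2.
    case/negP: (indep_nconn (sf_indep s2) pqT2).
    have := spans_conn (face_spans_threshold _ s2 z2) Fpq; apply: conn_sub.
    rewrite subsetD1 subsetIl /=; apply: contra pqF.
    by rewrite inE => /andP[].
  - by [].
  - by rewrite Ev -sub1set pqT1 oner_eq0.
  - exists 0, t => T2 s2; rewrite Et // Ev; case: (_ \in T2).
      by right; rewrite mulr1.
    by left; rewrite mulr0.
move=> no; right; pose S := [set z | conn F x z].
have flat p q : g p q -> p \in S -> q \in S -> [set p; q] \in F.
  rewrite !(in_set (fun _ => conn _ _ _)) => gpq xp xq.
  apply/negPn/negP => pqF; apply: no; exists p, q; split=> //.
  by apply: conn_trans xq; rewrite conn_sym.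
have closed p q : [set p; q] \in F -> p \in S -> q \in S.
  by rewrite !(in_set (fun _ => conn _ _ _)) => /conn1 h; move/conn_trans; apply.
exists S; split.
  move=> T1 s1 z1 p q pS qS.
  have Fpq : conn F p q.
    move: pS qS; rewrite !(in_set (fun _ => conn _ _ _)) => xp.
    by apply: conn_trans; rewrite conn_sym.
  have := spans_conn (face_spans_threshold (a [set x; y]) s1 z1) Fpq.
  move/conn_restrict => /(_ S); rewrite -/F => h.
  apply: conn_sub (h _ pS); last by move=> ? ?; rewrite inE => /andP[_]; apply: closed.
  apply/subsetP => e; rewrite inE => /andP[/setIP[eT1 eF] eS].
  by rewrite !inE eT1 eS (subsetP (sf_sub s1)).
have xS : x \in S by rewrite inE conn0.
(* Edges inside S have weight at most that of xy, so the heavier uv is not among them. Inside S the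
   new forest has only edges of T other than xy, and these separate x from y. *)
exists ([set u; v] |: T :\ [set x; y]), x, y; split=> //; first exact: closed xyF xS.
apply: contra (indep_nconn (sf_indep sT) xyT); apply: conn_sub.
apply/subsetP => e /setIP[/setU1P[->|//]]; rewrite induced2 => /and3P[_ uS vS].
by have := flat _ _ guv uS vS; rewrite inE leNgt lt andbF.
Qed.

(** At a cut vertex v let A be a component of S - v. Collapsing one side onto v shows that tightness
    on S gives tightness on both A + v and S - A; conversely, a forest tight on both is tight on S,
    by paths through v. Hence one of the two smaller sets inherits the forest that is not tight. *)
Lemma face_connects_bic T0 S : sf T0 -> ell T0 = 0 -> face_connects S ->
  bic_in g S \/ exists S', face_connects S' /\ (#|S'| < #|S|)%N.
Proof using gsym girr fac.
move=> s0 z0 [cS [T1 [p [q [s1 pS qS npq]]]]].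
apply: NNPP => /not_or_and[nb nsm]; apply: nb; split.
- have pq : p != q by apply: contraNneq npq => ->; apply: conn0.
  by apply/card_gt1P; exists p, q.
- move=> b d bS dS; apply: (connect_map (f := id) _ (cS _ s0 z0 _ _ bS dS)).
  by move=> s t; rewrite /adj /= inE induced2 => /andP[_ h]; apply: connect1.
move=> v; apply: NNPP => nc; apply: nsm.
have vS : v \in S.
  apply/negPn/negP => vS; apply: nc; have -> : S :\ v = S.
    by apply/setDidPl; rewrite disjoint_sym disjoints1.
  move=> b d bS dS; apply: (connect_map (f := id) _ (cS _ s0 z0 _ _ bS dS)).
  by move=> s t; rewrite /adj /= inE induced2 => /andP[_ h]; apply: connect1.
have [x xSv] : exists x, x \in S :\ v.
  by apply: NNPP => no; apply: nc => x y xSv; case: no; exists x.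
have [y ySv nxy] := connected_inP gsym nc xSv.
pose A := [set z | iconn g (S :\ v) x z].
have AS z : z \in A -> z \in S /\ z != v.
  rewrite inE => /iconn_in/(_ xSv); rewrite !inE => /andP[-> ->] //.
have vA : v \notin A by apply/negP => /AS[_]; rewrite eqxx.
have xA : x \in A by rewrite inE; apply: connect0.
have yA : y \notin A by rewrite inE.
have out b d : g b d -> b \in A -> d \in S -> d \notin A -> d = v.
  move=> bd bA dS dA; apply/eqP/negPn/negP => dv; case/negP: dA.
  have [bS bv] := AS _ bA; move: bA; rewrite !inE => xb.
  by apply: iconn_step xb bd _ _; rewrite !inE ?dv ?bv.
pose S1 := v |: A; pose S2 := S :\: A.
have c1 T : (forall p q, p \in S -> q \in S -> conn (T :&: induced S) p q) ->
    forall p q, p \in S1 -> q \in S1 -> conn (T :&: induced S1) p q.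
  move=> cT b d bS1 dS1; pose f z := if z \in A then z else v.
  have fE z : z \in S1 -> f z = z by rewrite /f => /setU1P[->|->] //; rewrite (negbTE vA).
  have S1S z : z \in S1 -> z \in S by case/setU1P=> [->|/AS[]].
  rewrite -(fE b bS1) -(fE d dS1).
  apply: (@conn_map _ (T :&: induced S)); last by apply: cT; apply: S1S.
  move=> s t; rewrite inE induced2 /f => /and4P[stT gst sS tS].
  case: (boolP (s \in A)) => sA; case: (boolP (t \in A)) => tA; last exact: conn0.
  - by apply: conn1; rewrite inE stT induced2 gst !setU1r.
  - have tv := out _ _ gst sA tS tA; subst t.
    by apply: conn1; rewrite inE stT induced2 gst setU11 setU1r.
  - have sv : s = v by apply: out tA sS sA; rewrite gsym.
    by subst s; apply: conn1; rewrite inE stT induced2 gst setU11 setU1r.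
have c2 T : (forall p q, p \in S -> q \in S -> conn (T :&: induced S) p q) ->
    forall p q, p \in S2 -> q \in S2 -> conn (T :&: induced S2) p q.
  move=> cT b d /setDP[bS bA] /setDP[dS dA]; pose f z := if z \in A then v else z.
  have fE z : z \notin A -> f z = z by rewrite /f => /negbTE ->.
  rewrite -(fE b bA) -(fE d dA).
  apply: (@conn_map _ (T :&: induced S)); last exact: cT.
  move=> s t; rewrite inE induced2 /f => /and4P[stT gst sS tS].
  case: (boolP (s \in A)) => sA; case: (boolP (t \in A)) => tA.
  - exact: conn0.
  - by have tv := out _ _ gst sA tS tA; subst t; apply: conn0.
  - have -> : s = v by apply: out tA sS sA; rewrite gsym.
    exact: conn0.
  - by apply: conn1; rewrite inE stT induced2 gst !in_setD sA tA sS tS.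
have le1 : (#|S1| < #|S|)%N.
  apply/proper_card/properP; split.
    by apply/subsetP => z /setU1P[->|/AS[]].
  exists y; first by move: ySv; rewrite inE => /andP[].
  by rewrite in_setU1 negb_or yA andbT; move: ySv; rewrite in_setD1 => /andP[].
have le2 : (#|S2| < #|S|)%N.
  apply/proper_card/properP; split; first exact: subsetDl.
  by exists x; [have [] := AS _ xA | rewrite in_setD xA].
case: (classic (forall p q, p \in S1 -> q \in S1 -> conn (T1 :&: induced S1) p q)) => d1.
- case: (classic (forall p q, p \in S2 -> q \in S2 -> conn (T1 :&: induced S2) p q)) => d2.
  + case/negP: npq.
    have sub S' : S' \subset S -> T1 :&: induced S' \subset T1 :&: induced S.
      move=> S'S; apply: setIS; apply/subsetP => e; rewrite !inE => /andP[-> h].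
      exact: subset_trans h S'S.
    have toV z : z \in S -> conn (T1 :&: induced S) z v.
      move=> zS; case: (boolP (z \in A)) => zA.
        apply: conn_sub (d1 z v _ _); rewrite ?setU11 ?setU1r //.
        by apply: sub; apply/subsetP => w /setU1P[->|/AS[]].
      apply: conn_sub (d2 z v _ _); rewrite ?in_setD ?zA ?vA //.
      by apply: sub; apply: subsetDl.
    by apply: conn_trans (toV p pS) _; rewrite conn_sym toV.
  + exists S2; split=> //; split; first by move=> T sT zT; apply/c2/cS.
    apply: NNPP => no; apply: d2 => b d bS dS; apply/negPn/negP => n.
    by apply: no; exists T1, b, d.
- exists S1; split=> //; split; first by move=> T sT zT; apply/c1/cS.
  apply: NNPP => no; apply: d1 => b d bS dS; apply/negPn/negP => n.
  by apply: no; exists T1, b, d.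
Qed.

Lemma face_connects_min T0 S : sf T0 -> ell T0 = 0 -> face_connects S ->
  exists S', face_connects S' /\ bic_in g S'.
Proof using gsym girr fac.
move=> s0 z0; have [n le] := ubnP #|S|; elim: n S le => // n IH S le fS.
case: (face_connects_bic s0 z0 fS) => [bS|[S' [fS' lt]]]; first by exists S.
by apply: IH fS'; apply: leq_trans lt _; rewrite -ltnS.
Qed.

End FacetStructure.

(** * From the values of a facet to attached vertices *)

Section FacetLevels.
Local Open Scope ring_scope.
Variables (R : realFieldType) (V : finType) (g : rel V).
Hypotheses (gsym : symmetric g) (girr : irreflexive g).
Variables (c : R) (a : {set V} -> R).
Hypothesis fac : facet_defining g c a.
Implicit Types (F I J K T : {set {set V}}) (x y u v : V) (S : {set V}).
Local Notation sf := (sf g).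
Local Notation ell := (aff_eval c a).

(** T0 restricted to G[S] is a basis there, so its size plays the part of the rank, and the values
    of the facet are the multiples of t by the deficit inside S. *)
Lemma facet_rank T0 S : sf T0 -> ell T0 = 0 -> face_connects g c a S ->
  exists t, forall T, sf T -> (#|T :&: induced g S| <= #|T0 :&: induced g S|)%N /\
    ell T = t * (#|T0 :&: induced g S|%:R - #|T :&: induced g S|%:R).
Proof using gsym girr fac.
move=> s0 z0 [cS [T1 [p [q [s1 pS qS npq]]]]].
set IS := induced g S.
have ISP x y : [set x; y] \in IS -> x \in S /\ y \in S.
  by rewrite induced2 // => /and3P[].
have IP T : T :&: IS \subset pairs V.
  apply: subset_trans (edges_pairs g); apply/subsetP => e.
  by rewrite !inE => /and3P[].
have iT T : sf T -> indep (T :&: IS).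
  by move=> sT; apply: indep_sub (sf_indep sT); apply: subsetIl.
have le T T' : sf T -> sf T' -> ell T = 0 -> (#|T' :&: IS| <= #|T :&: IS|)%N.
  move=> sT sT' zT; apply: steinitz => //; first exact: iT.
  by apply/spansP => x y /setIP[_ /ISP[xS yS]]; apply: cS.
have lt : (#|T1 :&: IS| < #|T0 :&: IS|)%N.
  have pqT : [set p; q] \notin T1 :&: IS by apply: contra npq; apply: conn1.
  have <- : #|[set p; q] |: (T1 :&: IS)| = #|T1 :&: IS|.+1 by rewrite cardsU1 pqT.
  apply: steinitz.
  - by rewrite subUset IP sub1set andbT; apply/pairsP; exists p, q.
  - exact: indep_add (iT _ s1) npq.
  - apply/spansP => x y /setU1P[/set2_inj[[-> ->]|[-> ->]]|/setIP[_ /ISP[xS yS]]];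
      exact: cS.
have [|||t Et] := @facet_prop R V g gsym girr c a #|T0 :&: IS|%:R
    (fun e => (-1) * (e \in IS)%:R) T1 fac _ _ s1.
- apply/(nonnegP gsym girr) => T sT; rewrite aff_count mulN1r subr_ge0 ler_nat.
  exact: le.
- move=> T sT zT; rewrite aff_count mulN1r.
  by have /eqP -> : #|T :&: IS| == #|T0 :&: IS|; rewrite ?subrr // eqn_leq !le.
- by rewrite aff_count mulN1r subr_eq0 eqr_nat neq_ltn lt orbT.
exists t => T sT; split; first exact: le.
by rewrite Et // aff_count mulN1r.
Qed.

Definition touching (K : {set V}) : {set {set V}} := [set e in edges g | ~~ [disjoint e & K]].

Lemma touching2 (K : {set V}) x y :
  ([set x; y] \in touching K) = g x y && ((x \in K) || (y \in K)).
Proof using gsym.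
rewrite inE edgeE // disjoints_subset subUset !sub1set !inE negb_and !negbK //.
Qed.

(* The dual of [facet_rank]: outside S the facet is carried by the component K
   of G - S that meets the edge entering an adjacent vertex. *)
Lemma facet_outside T0 S : sf T0 -> ell T0 = 0 -> face_connects g c a S ->
  exists K : {set V}, [/\ K \subset ~: S, connected_in g K,
    forall x y, g x y -> x \in K -> y \notin K -> y \in S &
    forall T, sf T -> (#|T0 :&: induced g S| + #|T0 :&: touching K| =
                       #|T :&: induced g S| + #|T :&: touching K|)%N].
Proof using gsym girr fac.
move=> s0 z0 fS; have [t Et] := facet_rank s0 z0 fS.
have [cS [_ [s [_ [_ sS _ _]]]]] := fS.
have [T [x [y [u [v [[sT zT] xyT [guv uvT] sT' nz]]]]]] := facet_adjacent gsym girr fac s0 z0.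
set T' := _ |: _ in sT' nz; set IS := induced g S in Et cS.
have card_swap (F : {set {set V}}) :
    (#|T' :&: F| + ([set x; y] \in F) = #|T :&: F| + ([set u; v] \in F))%N.
  have -> : #|T :&: F| = (([set x; y] \in F) + #|(T :\ [set x; y]) :&: F|)%N.
    rewrite (cardsD1 [set x; y]) inE xyT /=; congr (_ + #|pred_of_set _|)%N.
    by apply/setP => e; rewrite !inE andbA.
  have -> : #|T' :&: F| = (([set u; v] \in F) + #|(T :\ [set x; y]) :&: F|)%N.
    rewrite (cardsD1 [set u; v]) !inE eqxx /=; congr (_ + #|pred_of_set _|)%N.
    apply/setP => e; rewrite !inE; case: eqP => //= ->.
    by rewrite (negbTE uvT) andbF.
  by rewrite addnC addnA [RHS]addnAC.
have [leT' ET'] := Et _ sT'; have [leT ET] := Et _ sT.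
have t0 : t != 0 by apply: contra nz => /eqP t0; rewrite ET' t0 mul0r.
have ETT : #|T :&: IS| = #|T0 :&: IS|.
  move: ET; rewrite zT => /esym/eqP; rewrite mulf_eq0 (negbTE t0) subr_eq0 eqr_nat /=.
  by move/eqP.
have cI := card_swap IS.
have ltT' : (#|T' :&: IS| < #|T :&: IS|)%N.
  rewrite ltn_neqAle ETT leT' andbT; apply: contra nz => /eqP E.
  by rewrite ET' E subrr mulr0.
have xyIS : [set x; y] \in IS by move: cI ltT'; clear; case: (_ \in IS); case: (_ \in IS); lia.
have uvIS : [set u; v] \notin IS by move: cI ltT'; rewrite xyIS; clear; case: (_ \in IS) => //; lia.
rewrite xyIS (negbTE uvIS) in cI.
have /and3P[_ xS yS] : [&& g x y, x \in S & y \in S] by rewrite -induced2.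
(* The exchange loses an edge inside S, so uv has an end p outside S; K is the component of p in G -
   S. *)
have [p pS puv] : exists2 p, p \in ~: S & (p == u) || (p == v).
  move: uvIS; rewrite induced2 // guv /= negb_and.
  by case/orP => h; [exists u | exists v]; rewrite ?inE ?eqxx ?orbT.
pose K := [set z | iconn g (~: S) p z].
have KS : K \subset ~: S by apply: component_sub.
have KnS z : z \in K -> z \notin S by move/(subsetP KS); rewrite inE.
have pK : p \in K by rewrite inE; apply: connect0.
have Kout b d : g b d -> b \in K -> d \notin K -> d \in S.
  move=> bd bK; apply: contraR => dS; have bS := subsetP KS _ bK.
  by move: bK; rewrite !inE => pb; apply: iconn_step pb bd bS _; rewrite inE.
exists K; split=> //; first exact: component_connected.
set E := touching K.
have uvE : [set u; v] \in E.
  by rewrite touching2 guv; case/orP: puv => /eqP <-; rewrite pK ?orbT.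
have xyE : [set x; y] \notin E.
  by rewrite touching2 !negb_and negb_or; apply/orP; right;
    apply/andP; split; [apply: contraL xS | apply: contraL yS]; apply: KnS.
have cE := card_swap E; rewrite (negbTE xyE) uvE in cE.
(* A forest on the face has the fewest edges at K: it connects S inside G[S], so its edges away from
   K already span all edges away from K, since a detour through K enters and leaves by S. *)
have min T1 T2 : sf T1 -> ell T1 = 0 -> sf T2 -> (#|T1 :&: E| <= #|T2 :&: E|)%N.
  move=> s1 z1 s2; have : (#|T2 :\: E| <= #|T1 :\: E|)%N.
    apply: (@steinitz_edges V g).
    - exact: subset_trans (subsetDl _ _) (sf_sub s2).
    - by apply: indep_sub (sf_indep s2); apply: subsetDl.
    - apply/spansP => b d /setDP[bdT bdE].
      have gbd : g b d by rewrite -(edgeE gsym) (subsetP (sf_sub s2)).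
      move: bdE; rewrite touching2 gbd /= negb_or => /andP[bK dK].
      pose f z := if z \in K then s else z.
      have <- : f b = b by rewrite /f (negbTE bK).
      have <- : f d = d by rewrite /f (negbTE dK).
      apply: (@conn_map _ T1); last first.
        by apply: (elimT (spansP _ _) (sf_spans s1)); rewrite edgeE.
      have toS z : z \in S -> conn (T1 :\: E) s z.
        move=> zS; apply: conn_sub (cS _ s1 z1 _ _ sS zS).
        apply/subsetP => e /setIP[eT1 eIS]; rewrite inE eT1 andbT.
        move: eIS; rewrite !inE => /andP[_ eS]; rewrite negb_and negbK.
        apply/orP; right; rewrite disjoints_subset; apply: subset_trans eS _.
        by rewrite subsetC.
      move=> i j ijT; have gij : g i j by rewrite -(edgeE gsym) (subsetP (sf_sub s1)).
      rewrite /f; case: (boolP (i \in K)) => iK; case: (boolP (j \in K)) => jK.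
      + exact: conn0.
      + by apply: toS; apply: Kout gij iK jK.
      + by rewrite conn_sym; apply: toS; apply: Kout jK iK; rewrite gsym.
      + by apply: conn1; rewrite inE ijT andbT touching2 gij negb_or iK.
  have := sf_card s1 s2; rewrite -(cardsID E T1) -(cardsID E T2) => eqc le.
  by rewrite -(leq_add2r #|T2 :\: E|) -eqc leq_add2l.
have eqE : #|T :&: E| = #|T0 :&: E| by apply/eqP; rewrite eqn_leq !min.
have eT' : #|T' :&: E| = #|T0 :&: E|.+1.
  by rewrite -eqE -[LHS]addn0 -addn1; exact: cE.
have eI' : #|T0 :&: IS| = #|T' :&: IS|.+1.
  by rewrite -ETT -[LHS]addn0 -addn1; exact: esym cI.
have [|||t2 Et2] := @facet_prop R V g gsym girr c a (- #|T0 :&: E|%:R)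
    (fun e => 1 * (e \in E)%:R) T' fac _ _ sT'.
- apply/(nonnegP gsym girr) => T1 s1; rewrite aff_count mul1r addrC subr_ge0 ler_nat.
  exact: min.
- move=> T1 s1 z1; rewrite aff_count mul1r.
  by have /eqP -> : #|T1 :&: E| == #|T0 :&: E|; rewrite ?addNr // eqn_leq !min.
- by rewrite aff_count mul1r addrC subr_eq0 eqr_nat eT' neq_ltn ltnSn orbT.
(* The exchange changes both counts by exactly one, so evaluation at T' identifies the two
   factors. *)
have tt2 : t = t2.
  have := Et2 _ sT'; rewrite ET' aff_count mul1r.
  rewrite eT' eI'.
  by rewrite -!natr1; lra.
move=> T1 s1; have [_] := Et _ s1; rewrite Et2 // -tt2 aff_count mul1r.
move/(mulfI t0) => h; apply/eqP; rewrite -(eqr_nat R) !natrD; apply/eqP; move: h; clear; lra.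
Qed.

(** Falling short by k inside S means a surplus of at least k edges at K. The edges of T0 at K
    together with a star on the attachment set N span every edge at K, so the surplus is at most |N|
    - 1. *)
Lemma facet_attachments k T0 S T2 : (0 < k)%N -> sf T0 -> ell T0 = 0 ->
  face_connects g c a S -> sf T2 ->
  (#|T2 :&: induced g S| + k <= #|T0 :&: induced g S|)%N ->
  exists K : {set V}, [/\ K \subset ~: S, connected_in g K &
    (k < #|[set s in S | [exists z in K, g s z]]|)%N].
Proof using gsym girr fac.
move=> k0 s0 z0 fS s2 lev; have [K [KS cK Kout card]] := facet_outside s0 z0 fS.
exists K; split=> //; set N := [set s in S | _].
set E := touching K in card; have cT2 := card _ s2.
have bound n0 : (#|T2 :&: E| <= #|T0 :&: E| + #|N :\ n0|)%N.
  (* The star need not consist of edges of the graph; it stands for the connections of T0 that run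
     outside K. *)
  pose star : {set {set V}} := [set [set n0; n] | n in N :\ n0].
  have N1 x y : g x y -> x \in K -> y \notin K -> y \in N.
    move=> xy xK yK; rewrite inE (Kout _ _ xy xK yK) /=.
    by apply/existsP; exists x; rewrite xK gsym.
  have starP n : n \in N -> conn ((T0 :&: E) :|: star) n0 n.
    move=> nN; have [->|nn] := eqVneq n n0; first exact: conn0.
    by apply: conn1; rewrite inE; apply/orP; right; apply: imset_f; rewrite in_setD1 nn.
  apply: (@leq_trans #|(T0 :&: E) :|: star|); last first.
    apply: leq_trans (leq_card_setU _ _) _; rewrite leq_add2l; exact: leq_imset_card.
  apply: (@steinitz_edges V g).
  - exact: subset_trans (subsetIl _ _) (sf_sub s2).
  - by apply: indep_sub (sf_indep s2); apply: subsetIl.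
  pose f z := if z \in K then z else n0.
  have step x y : [set x; y] \in T0 -> conn (T0 :&: E :|: star) (f x) (f y).
    move=> xyT; have gxy : g x y by rewrite -(edgeE gsym) (subsetP (sf_sub s0)).
    have inE1 : (x \in K) || (y \in K) -> conn (T0 :&: E :|: star) x y.
      by move=> h; apply: conn1; rewrite !in_setU in_setI xyT touching2 gxy h.
    rewrite /f; case: (boolP (x \in K)) => xK; case: (boolP (y \in K)) => yK.
    + by apply: inE1; rewrite xK.
    + apply: conn_trans (inE1 _) _; first by rewrite xK.
      by rewrite conn_sym; apply: starP; apply: N1 gxy xK yK.
    + apply: conn_trans (starP x _) (inE1 _); last by rewrite yK orbT.
      by apply: N1 yK xK; rewrite gsym.
    + exact: conn0.
  apply/spansP => x y /setIP[xyT2 xyE].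
  have gxy : g x y by rewrite -(edgeE gsym) (subsetP (sf_sub s2)).
  have := conn_map step (elimT (spansP _ _) (sf_spans s0) x y _).
  rewrite edgeE // => /(_ gxy); move: xyE; rewrite touching2 gxy /f /=.
  case: (boolP (x \in K)) => xK; case: (boolP (y \in K)) => yK //= _ h.
  + by apply: conn_trans h _; apply: starP; apply: N1 gxy xK yK.
  + apply: conn_trans h; rewrite conn_sym; apply: starP.
    by apply: N1 yK xK; rewrite gsym.
have arith (n1 n2 n3 n4 n : nat) : (n1 + n2 = n3 + n4 -> n4 <= n2 + n ->
  n3 + k <= n1 -> k <= n)%N by clear; lia.
(* The bound is used twice: an arbitrary centre in S shows that N is nonempty, and a centre in N
   then gains the missing unit. *)
have [s0S s0S'] : exists s, s \in S by case: fS => _ [_ [p [_ [_ pS _ _]]]]; exists p.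
have kN : (k <= #|N :\ s0S|)%N := arith _ _ _ _ _ cT2 (bound s0S) lev.
have/card_gt0P[n0] := leq_trans k0 kN; rewrite in_setD1 => /andP[_ n0N].
by rewrite (cardsD1 n0 N) n0N ltnS; apply: arith _ _ _ _ _ cT2 (bound _) lev.
Qed.

Lemma facet_levels k : (0 < k)%N ->
  (forall s : seq R, (size s <= k)%N -> exists2 T, sf T & aff_eval c a T \notin s) ->
  exists h : rel 'I_k.+1,
    [/\ symmetric h, irreflexive h, minimally_biconnected h & has_minor g (cone h)].
Proof using gsym girr fac.
move=> k0 many.
case: (facet_zero gsym girr fac) => [[T0 s0 z0]|[r Er]]; last first.
  have [T sT] := many [:: r] k0.
  by rewrite inE Er // eqxx.
(* The two-valued alternative below is excluded only for k at least 2. For k = 1 an edge missing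
   from some forest suffices. *)
have [k1|k1] := eqVneq k 1%N.
  subst k; have [T [x [y [u [v [[sT zT] _ [guv uvT] _ _]]]]]] := facet_adjacent gsym girr fac s0 z0.
  exact: nonbridge_cone sT guv uvT.
case: (facet_cases gsym girr fac s0 z0) => [[r1 [r2 Er]]|[S1 fS1]].
  have [|T sT] := many [:: r1; r2]; first by move: k0 k1; clear; case: k => [|[|k]].
  by rewrite !inE; case: (Er T sT) => ->; rewrite eqxx ?orbT.
have [S [fS bS]] := face_connects_min gsym girr fac s0 z0 fS1.
have [t Et] := facet_rank s0 z0 fS.
(* These are the values for deficits 0 to k - 1, so a forest avoiding them has deficit at least
   k. *)
have [|T2 s2 lev] := many [seq t * i%:R | i <- iota 0 k].
  by rewrite size_map size_iota.
have {}lev : (#|T2 :&: induced g S| + k <= #|T0 :&: induced g S|)%N.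
  rewrite leqNgt; apply: contra lev => lt; have [le ->] := Et _ s2.
  rewrite -natrB //; by apply: map_f; rewrite mem_iota add0n leq0n ltn_subLR.
have [K [KS cK kN]] := facet_attachments k0 s0 z0 fS s2 lev.
apply: cone_minor kN => //.
by rewrite disjoint_sym disjoints_subset.
Qed.

End FacetLevels.

(** * From cone minors to facets *)

Lemma subset_of_card (T : finType) (A : {set T}) m :
  m <= #|A| -> exists2 C : {set T}, C \subset A & #|C| = m.
Proof.
move=> le; exists [set x in take m (enum A)].
  by apply/subsetP => x; rewrite inE => /mem_take; rewrite mem_enum.
rewrite cardsE (card_uniqP _) ?take_uniq ?enum_uniq // size_take -cardE.
by case: ltngtP le.
Qed.

Section ConeModel.
Variables (V : finType) (g : rel V).
Hypotheses (gsym : symmetric g) (girr : irreflexive g).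
Variables (I : finType) (h : rel I) (B : option I -> {set V}).
Hypotheses (hirr : irreflexive h) (hbic : biconnected h).
Hypothesis B0 : forall w, B w != set0.
Hypothesis Bd : forall w w', w != w' -> [disjoint B w & B w'].
Hypothesis Bc : forall w, connected_in g (B w).
Hypothesis Be : forall w w', cone h w w' ->
  exists x y, [/\ x \in B w, y \in B w' & g x y].
Implicit Types (J K T : {set {set V}}) (x y u v : V) (w : option I).

Lemma block_uniq w w' x : x \in B w -> x \in B w' -> w = w'.
Proof using Bd.
move=> xw xw'; apply/eqP/negPn/negP => ne.
by have := disjointFr (Bd ne) xw; rewrite xw'.
Qed.

(* In the model of cone(H), the edges in [inner] get contracted, [rungs] lie
   over the edges of H and [spokes] over those at the apex. *)
Definition rim := \bigcup_i B (Some i).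

Lemma rimP x : reflect (exists i, x \in B (Some i)) (x \in rim).
Proof.
by apply: (iffP bigcupP) => [[i _ xi]|[i xi]]; exists i.
Qed.

Lemma hub_rim x : x \in B None -> x \notin rim.
Proof using Bd. by move=> xN; apply/rimP => -[i /(block_uniq xN)]. Qed.

Definition inner := [set e in edges g | [exists w, e \subset B w]].
(** After contraction of [inner] this is the part over H, a hyperplane of [whole]: one spoke
    completes any basis of it. *)
Definition flat := induced g rim :|: induced g (B None).
Definition whole := induced g (rim :|: B None).
Definition spokes := whole :\: flat.

Lemma innerP x y :
  reflect (g x y /\ exists2 w, x \in B w & y \in B w) ([set x; y] \in inner).
Proof using gsym.
rewrite inE edgeE //; apply: (iffP andP) => [[gxy /existsP[w]]|[gxy [w xw yw]]].
  by rewrite subUset !sub1set => /andP[xw yw]; split=> //; exists w.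
by split=> //; apply/existsP; exists w; rewrite subUset !sub1set xw.
Qed.

Lemma block_rim i x : x \in B (Some i) -> x \in rim.
Proof. by move=> xi; apply/rimP; exists i. Qed.

Lemma inner_flat : inner \subset flat.
Proof using gsym.
apply/subsetP => e eI; have := eI; rewrite inE => /andP[/edgesP[x [y [E gxy]]] _].
subst e; have /innerP[_ [[i|] xw yw]] := eI; rewrite inE !induced2 // gxy /=.
  by rewrite !(block_rim (i := i)).
by rewrite xw yw orbT.
Qed.

Lemma flat_whole : flat \subset whole.
Proof.
apply/subsetP => e; rewrite !inE => /orP[] /andP[-> /=] h1; apply: subset_trans h1 _.
  exact: subsetUl.
exact: subsetUr.
Qed.

Lemma whole_edges : whole \subset edges g.
Proof. by apply/subsetP => e; rewrite inE => /andP[]. Qed.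

Lemma flat_edges : flat \subset edges g.
Proof. exact: subset_trans flat_whole whole_edges. Qed.

Lemma inner_edges : inner \subset edges g.
Proof. by apply/subsetP => e; rewrite inE => /andP[]. Qed.

Lemma flat_rim x y : [set x; y] \in flat -> x \in rim -> y \in rim.
Proof using gsym Bd.
rewrite inE !induced2 // => /orP[/and3P[_ _ ->] //|/and3P[_ xN _]].
by move/negP: (hub_rim xN).
Qed.

Lemma spokesP e : e \in spokes ->
  exists x y, [/\ e = [set x; y], g x y, x \in rim & y \in B None].
Proof using gsym Bd.
rewrite inE => /andP[nf ew]; have := subsetP whole_edges _ ew.
case/edgesP=> x [y [E gxy]]; subst e; move: ew nf; rewrite /whole /flat in_setU !induced2 // gxy /= !in_setU.
case: (boolP (x \in rim)) => xr; case: (boolP (y \in rim)) => yr //=.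
- by move=> yN _; exists x, y.
- by rewrite andbT => xN _; exists y, x; rewrite set2C gsym.
- by move=> ->.
Qed.

Lemma spokeE x y : g x y -> x \in rim -> y \in B None -> [set x; y] \in spokes.
Proof using gsym Bd.
move=> gxy xr yN; rewrite in_setD /whole /flat in_setU !induced2 // gxy /= !in_setU xr yN orbT /=.
rewrite (negbTE (hub_rim yN)) /= !andbT.
by apply: contraL xr => xN; apply: hub_rim.
Qed.

Lemma inner_conn w x y : x \in B w -> y \in B w -> conn inner x y.
Proof using gsym Bc.
move=> xw yw; apply: (connect_map (f := id) _ (Bc xw yw)) => s t /= /and3P[st sw tw].
by apply: conn1; apply/innerP; split=> //; exists w.
Qed.

Lemma block_conn J (e : rel (option I)) : spans J inner ->
  (forall w w', e w w' -> exists x y, [/\ x \in B w, y \in B w' & conn J x y]) ->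
  forall w w' x y, connect e w w' -> x \in B w -> y \in B w' -> conn J x y.
Proof using gsym Bc.
move=> sJ eJ w w' x y /connectP[p]; elim: p w x => [|w1 p IH] w x /=.
  by move=> _ -> xw yw; apply: spans_conn sJ (inner_conn xw yw).
move=> /andP[/eJ[s [t [sw tw1 st]]] pp] l xw yw.
apply: conn_trans (spans_conn sJ (inner_conn xw sw)) (conn_trans st _).
exact: IH pp l tw1 yw.
Qed.

Definition flat_basis J := [/\ J \subset flat, indep J & spans J flat].

Lemma rim_conn J x y : spans J flat -> x \in rim -> y \in rim -> conn J x y.
Proof using gsym Bc Be hbic.
move=> sJ /rimP[i xi] /rimP[j yj].
have sJi : spans J inner := spans_sub inner_flat sJ.
have [_ [hc _]] := hbic.
pose e : rel (option I) := fun w w' => if (w, w') is (Some i, Some j) then h i j else false.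
apply: (block_conn (e := e) sJi) xi yj; last first.
  apply: (connect_map (f := Some) _ (hc i j (in_setT _) (in_setT _))).
  by move=> a b /= /andP[ab _]; apply: connect1.
case=> [a|] [b|] //= ab; have [s [t [sa tb st]]] := @Be (Some a) (Some b) ab.
exists s, t; split=> //; apply: (elimT (spansP _ _) sJ).
by rewrite inE induced2 // st (block_rim sa) (block_rim tb).
Qed.

Lemma hub_conn J x y : spans J flat -> x \in B None -> y \in B None -> conn J x y.
Proof using gsym Bc.
by move=> sJ xN yN; apply: spans_conn (spans_sub inner_flat sJ) (inner_conn xN yN).
Qed.

Lemma spoke_spans J s : spans J flat -> s \in spokes -> spans (s |: J) whole.
Proof using gsym Bd Bc Be hbic.
move=> sJ ss; have [p [q [E gpq pr qN]]] := spokesP ss; subst s.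
have JsJ := subsetUr [set [set p; q]] J.
apply/spansP => x y xyw; case: (boolP ([set x; y] \in flat)) => xyf.
  exact: conn_sub JsJ (elimT (spansP _ _) sJ _ _ xyf).
have [p' [q' [E gpq' pr' qN']]] : exists x' y',
    [/\ [set x; y] = [set x'; y'], g x' y', x' \in rim & y' \in B None].
  by apply: spokesP; rewrite inE xyf.
have c : conn ([set p; q] |: J) p' q'.
  apply: conn_trans (conn_sub JsJ (rim_conn sJ pr' pr)) _.
  apply: conn_trans (conn1 _) (conn_sub JsJ (hub_conn sJ qN qN')).
  exact: setU11.
by case: (set2_inj E) => -[-> ->]; rewrite // conn_sym.
Qed.

Lemma spoke_indep J s : flat_basis J -> s \in spokes -> indep (s |: J).
Proof using gsym Bd.
case=> [Jf iJ sJ] ss; have [p [q [E gpq pr qN]]] := spokesP ss; subst s.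
apply: indep_add iJ _; apply/negP => c; have := hub_rim qN; apply/negP/negPn.
by apply: conn_closed c pr => x y xyJ; apply: flat_rim; apply: (subsetP Jf).
Qed.

Lemma spoke_exists i : exists x y,
  [/\ [set x; y] \in spokes, g x y, x \in B (Some i) & y \in B None].
Proof using gsym Bd Be.
have [x [y [xi yN gxy]]] := @Be (Some i) None isT.
by exists x, y; split=> //; apply: spokeE gxy (block_rim xi) yN.
Qed.

Lemma star_spans J : spans J inner -> spokes \subset J -> spans J whole.
Proof using gsym B0 Bd Bc Be.
move=> sJi sJ.
pose e : rel (option I) := fun w w' => (w == None) || (w' == None).
have eJ w w' : e w w' -> exists x y, [/\ x \in B w, y \in B w' & conn J x y].
  have eN w1 : exists x y, [/\ x \in B w1, y \in B None & conn J x y].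
    case: w1 => [i|]; last first.
      by have /set0Pn[x xN] := B0 None; exists x, x; split=> //; apply: conn0.
    have [x [y [xys gxy xi yN]]] := spoke_exists i.
    by exists x, y; split=> //; apply: conn1; apply: (subsetP sJ).
  case/orP=> /eqP ->; last exact: eN.
  by have [x [y [? ? ?]]] := eN w'; exists y, x; rewrite conn_sym.
have blk x : x \in rim :|: B None -> exists w, x \in B w.
  by case/setUP=> [/rimP[i]|]; [exists (Some i) | exists None].
apply/spansP => x y; rewrite induced2 // => /and3P[_ /blk[w xw] /blk[w' yw']].
apply: (block_conn sJi eJ) xw yw'.
by apply: (connect_trans (y := None)); apply: connect1; rewrite /e eqxx ?orbT.
Qed.

(** All edges between distinct rim blocks, including those not over an edge of H. *)
Definition rungs := flat :\: inner.

Lemma rungsP e : e \in rungs -> exists i j x y,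
  [/\ e = [set x; y], g x y, x \in B (Some i), y \in B (Some j) & i != j].
Proof using gsym.
rewrite inE => /andP[ni ef]; have := subsetP flat_edges _ ef.
case/edgesP=> x [y [E gxy]]; subst e.
move: ef; rewrite inE !induced2 // gxy /= => /orP[/andP[/rimP[i xi] /rimP[j yj]]|/andP[xN yN]].
  exists i, j, x, y; split=> //; apply: contra ni => /eqP ij; subst j.
  by apply/innerP; split=> //; exists (Some i).
by case/negP: ni; apply/innerP; split=> //; exists None.
Qed.

Lemma rungE x y i j : g x y -> x \in B (Some i) -> y \in B (Some j) -> i != j ->
  [set x; y] \in rungs.
Proof using gsym Bd.
move=> gxy xi yj ij; rewrite inE; apply/andP; split.
  apply/innerP => -[_ [w xw yw]]; case/eqP: ij.
  by have := block_uniq xi xw; rewrite -(block_uniq yj yw) => -[].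
by rewrite inE induced2 // gxy (block_rim xi) (block_rim yj).
Qed.

(* Exchanging rungs at the block i: a basis of the flat consists of [inner], a
   basis of the rungs avoiding i (H - i is connected), and any rung at i. *)
Lemma rung_exchange (A : {set {set V}}) i : A \subset inner -> indep A -> spans A inner ->
  exists J, forall e, e \in rungs -> ~~ [disjoint e & B (Some i)] ->
    e \notin J /\ flat_basis (e |: J).
Proof using gsym Bd Bc Be hirr hbic.
move=> Ai iA sA.
pose F := [set f in flat | (f \in inner) || [disjoint f & B (Some i)]].
have Ff : F \subset flat by apply/subsetP => f; rewrite inE => /andP[].
have iF : inner \subset F.
  by apply/subsetP => f fi; rewrite inE fi (subsetP inner_flat).
have FE := subset_trans Ff flat_edges.
have [J [AJ JF iJ sJ]] := basis_extend (subset_trans FE (edges_pairs g)) (subset_trans Ai iF) iA.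
have clF x y : [set x; y] \in F -> x \in B (Some i) -> y \in B (Some i).
  rewrite inE => /andP[_ /orP[/innerP[_ [w xw yw]] xi|]].
    by rewrite (block_uniq xi xw).
  by move=> d xi; have := disjointFr d (set21 x y); rewrite xi.
exists J => e er nd.
have [p [q [j [E gpq pi qj ij]]]] : exists p q j,
    [/\ e = [set p; q], g p q, p \in B (Some i), q \in B (Some j) & i != j].
  have [i' [j [x [y [E gxy xi yj ij]]]]] := rungsP er.
  move: nd; rewrite E disjoints_subset subUset !sub1set !inE negb_and !negbK.
  case/orP=> h1.
  - have [E'] := block_uniq h1 xi; subst i'.
    by exists x, y, j.
  - have [E'] := block_uniq h1 yj; subst j.
    by exists y, x, i'; rewrite set2C gsym eq_sym.
subst e; have qi : q \notin B (Some i).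
  by apply: contra ij => qi; have [->] := block_uniq qi qj.
have npq : ~~ conn J p q.
  apply: contra qi => c; apply: conn_closed c pi => x y xyJ; apply: clF.
  exact: (subsetP JF).
split; first by apply: contra npq; apply: conn1.
have JeJ := subsetUr [set [set p; q]] J.
split.
- rewrite subUset sub1set (subset_trans JF Ff) andbT.
  by move: er; rewrite inE => /andP[].
- exact: indep_add.
have [_ [_ hc]] := hbic.
have sJi : spans ([set p; q] |: J) inner.
  exact: sub_spans JeJ (spans_sub iF sJ).
(* The edges of H - i, with i attached to j by the edge pq. *)
pose e : rel (option I) := fun w w' => if (w, w') is (Some s, Some t)
  then [|| [&& h s t, s != i & t != i], (s, t) == (i, j) | (s, t) == (j, i)] else false.
have eJ w w' : e w w' -> exists x y, [/\ x \in B w, y \in B w' & conn ([set p; q] |: J) x y].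
  case: w w' => [s|] [t|] //= /or3P[/and3P[st si ti]|/eqP[-> ->]|/eqP[-> ->]].
  - have [x [y [xs yt gxy]]] := @Be (Some s) (Some t) st; exists x, y; split=> //.
    apply: conn_sub JeJ (elimT (spansP _ _) sJ _ _ _).
    rewrite inE; apply/andP; split.
      by rewrite inE induced2 // gxy (block_rim xs) (block_rim yt).
    apply/orP; right; rewrite disjoints_subset subUset !sub1set !inE.
    apply/andP; split; [apply: contra si => xi | apply: contra ti => xi].
      by have [->] := block_uniq xi xs.
    by have [->] := block_uniq xi yt.
  - by exists p, q; split=> //; apply: conn1; apply: setU11.
  - by exists q, p; split=> //; apply: conn1; rewrite set2C; apply: setU11.
have hcon s t : s != i -> t != i -> connect e (Some s) (Some t).
  move=> si ti; have /(_ _ _) c := hc i s t; move: c; rewrite !inE => /(_ si ti).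
  apply: (connect_map (f := Some)) => a b /= /and3P[ab].
  by rewrite !inE => ai bi; apply: connect1; rewrite /e ab ai bi.
have ji : j != i by rewrite eq_sym.
have con s t : connect e (Some s) (Some t).
  have toj s' : connect e (Some s') (Some j) /\ connect e (Some j) (Some s').
    have [->|s'i] := eqVneq s' i; last by split; apply: hcon.
    by split; apply: connect1; rewrite /e /= !eqxx ?orbT.
  by apply: connect_trans (toj s).1 (toj t).2.
apply/spansP => x y; rewrite inE !induced2 // => /orP[/and3P[_ /rimP[s xs] /rimP[t yt]]|].
  exact: (block_conn sJi eJ) (con s t) xs yt.
by move=> /and3P[_ xN yN]; apply: spans_conn sJi (inner_conn xN yN).
Qed.


Lemma exists_rung j j' : h j j' -> exists x y,
  [/\ [set x; y] \in rungs, x \in B (Some j) & y \in B (Some j')].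
Proof using gsym Bd Be hirr.
move=> jj; have [x [y [xj yj gxy]]] := @Be (Some j) (Some j') jj.
exists x, y; split=> //; apply: rungE gxy xj yj _.
by apply: contraTneq jj => ->; rewrite hirr.
Qed.

(** Consecutive blocks on a path of H share a rung, so local equality propagates through the
    connected graph H. *)
Lemma rungs_const (X : Type) (a : {set V} -> X) :
  (forall i e e', e \in rungs -> e' \in rungs -> ~~ [disjoint e & B (Some i)] ->
     ~~ [disjoint e' & B (Some i)] -> a e = a e') ->
  forall e e', e \in rungs -> e' \in rungs -> a e = a e'.
Proof using gsym Bd Be hirr hbic.
move=> loc e e' er er'.
have meet f x i : x \in f -> x \in B (Some i) -> ~~ [disjoint f & B (Some i)].
  by move=> xf xi; apply/negP => /disjointFr/(_ xf); rewrite xi.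
have [i [i1 [x [x1 [E _ xi _ _]]]]] := rungsP er.
have [j [j1 [y [y1 [E' _ yj _ _]]]]] := rungsP er'.
have ei : ~~ [disjoint e & B (Some i)] by apply: meet xi; rewrite E set21.
have ej : ~~ [disjoint e' & B (Some j)] by apply: meet yj; rewrite E' set21.
have [_ [hc _]] := hbic.
have /connectP[p pp lp] := hc i j (in_setT _) (in_setT _).
elim: p i e er {x x1 i1 xi E} ei pp lp => [|i' p IH] i f fr fi /=.
  by move=> _ ji; subst j; apply: loc fr er' fi ej.
move=> /andP[/andP[ii' _] pp] lp.
have [s [t [str si ti']]] := exists_rung ii'.
have sti : ~~ [disjoint [set s; t] & B (Some i)] by apply: meet si; apply: set21.
rewrite (loc i f [set s; t]) //.
apply: (IH i' _ str _ pp lp).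
by apply: meet ti'; apply: set22.
Qed.

(** Without rungs, J can leave a rim block only by a spoke at that block. Each block must reach the
    hub, and different blocks use different spokes. *)
Lemma spokes_transversal (A J : {set {set V}}) : A \subset inner -> spans J whole ->
  J \subset inner :|: spokes -> spans A inner -> A \subset J -> indep J ->
  J :\: A \subset spokes /\ #|I| <= #|J :\: A|.
Proof using gsym Bd Bc Be.
move=> Ai sJ Jis sA AJ iJ.
have JAi e : e \in J :\: A -> e \notin inner.
  rewrite inE => /andP[eA eJ]; apply/negP => ei.
  have /edgesP[x [y [E _]]] := subsetP inner_edges _ ei; subst e.
  case/negP: (indep_nconn iJ eJ).
  by apply: conn_sub (elimT (spansP _ _) sA _ _ ei); rewrite subsetD1 AJ.
have JAs e : e \in J :\: A -> e \in spokes.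
  move=> eJA; have := JAi e eJA; move: eJA; rewrite inE => /andP[_ /(subsetP Jis)].
  by case/setUP=> [->|].
split; first by apply/subsetP.
have F i : exists e, e \in J :\: A /\
    forall x, x \in e -> x \in rim -> x \in B (Some i).
  have [x [y [xys gxy xi yN]]] := spoke_exists i.
  have c : conn J x y.
    by apply: (elimT (spansP _ _) sJ); move: xys; rewrite inE => /andP[].
  have yi : y \notin B (Some i) by apply/negP => /(block_uniq yN).
  have [p [q [pq pi qi]]] := connect_exit c xi yi.
  have pqJA : [set p; q] \in J :\: A.
    rewrite in_setD; apply/andP; split; last exact: pq.
    apply: contra qi => /(subsetP Ai)/innerP[_ [w pw qw]].
    by rewrite (block_uniq pi pw).
  exists [set p; q]; split=> // z /set2P[-> //|->].
  have [x' [y' [E _ xr yN']]] := spokesP (JAs _ pqJA).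
  case: (set2_inj E) => -[E1 E2]; last first.
    by move: yN'; rewrite -E1 => /hub_rim; rewrite (block_rim pi).
  by rewrite E2 (negbTE (hub_rim yN')).
have [f fP] := fin_all_exists F.
have finj : injective f.
  move=> i j ij; have [fi hi] := fP i; have [_ hj] := fP j.
  have [x [y [E _ xr _]]] := spokesP (JAs _ fi).
  have xf : x \in f i by rewrite E set21.
  have := hj x; rewrite -ij => /(_ xf xr) xj.
  by have [->] := block_uniq (hi x xf xr) xj.
rewrite -cardsT -(card_imset _ finj); apply: subset_leq_card.
by apply/subsetP => _ /imsetP[i _ ->]; have [] := fP i.
Qed.

Local Open Scope ring_scope.
Variable R : realFieldType.
Implicit Types (c : R) (a : {set V} -> R).
Local Notation sf := (sf g).

Lemma sum_const a (F : {set {set V}}) (r : R) :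
  (forall e, e \in F -> a e = r) -> \sum_(e in F) a e = r * #|F|%:R.
Proof. by move=> E; rewrite (eq_bigr (fun=> r)) // sumr_const mulr_natr. Qed.

(* Every spanning forest below has the form [J :|: Z], where J spans [whole]
   and Z is fixed, so only the minor matters. *)
Lemma exists_rest (D : {set {set V}}) : D \subset whole -> indep D -> spans D whole ->
  exists2 Z : {set {set V}}, [disjoint whole & Z] &
    forall J, J \subset whole -> indep J -> spans J whole ->
      sf (J :|: Z) /\ #|J| = #|D|.
Proof using gsym.
move=> Dw iD sD; have DE := subset_trans Dw whole_edges.
have [T sT DT] := sf_extend DE iD.
have dZ : [disjoint whole & T :\: D].
  apply/pred0P => e /=; apply/negP => /andP[ew /setDP[eT eD]].
  have /edgesP[x [y [E gxy]]] := subsetP whole_edges _ ew; subst e.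
  case/negP: (indep_nconn (sf_indep sT) eT).
  by apply: conn_sub (elimT (spansP _ _) sD _ _ ew); rewrite subsetD1 DT.
exists (T :\: D) => // J Jw iJ sJ.
have JE := subset_trans Jw whole_edges.
have cJ : #|J| = #|D|.
  by apply/eqP; rewrite eqn_leq !(@steinitz_edges V g) //;
    [apply: spans_sub Dw sJ | apply: spans_sub Jw sD].
split=> //; apply: (sf_spans_card sT).
- by rewrite subUset JE (subset_trans (subsetDl _ _) (sf_sub sT)).
- apply: spans_trans (sf_spans sT); apply/spansP => x y xyT.
  case: (boolP ([set x; y] \in D)) => xyD.
    apply: conn_sub (elimT (spansP _ _) sJ _ _ (subsetP Dw _ xyD)).
    exact: subsetUl.
  by apply: conn1; rewrite !inE xyD xyT orbT.
- apply: leq_trans (leq_card_setU _ _) _; rewrite cJ -(cardsID D T).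
  by rewrite (setIidPr DT).
Qed.

Lemma cone_level k : (0 < k)%N -> (k < #|I|)%N -> ~ k_level R g k.
Proof using gsym girr hirr hbic B0 Bd Bc Be.
move=> k0 kI lev.
have wp := subset_trans whole_edges (edges_pairs g).
have fw := flat_whole; have if' := inner_flat.
have fp := subset_trans fw wp; have ip := subset_trans if' fp.
have iw := subset_trans if' fw.
have spw : spokes \subset whole by apply: subsetDl.
have [A [_ Ai iA sA]] := basis_extend ip (sub0set _) (indep0 V).
have [TF [ATF TFf iTF sTF]] := basis_extend fp (subset_trans Ai if') iA.
have isw : inner :|: spokes \subset whole by rewrite subUset iw spw.
(* Spokes and [inner] span [whole], so K is completed to a basis by spokes alone. *)
have ext K : A \subset K -> K \subset TF -> indep K -> exists J,
    [/\ K \subset J, J \subset whole, indep J, spans J whole & J :\: K \subset spokes].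
  move=> AK KTF iK.
  have KF := subset_trans KTF TFf.
  have Ksw : K :|: spokes \subset whole by rewrite subUset (subset_trans KF fw) spw.
  have [J [KJ JKs iJ sJ]] := basis_extend (subset_trans Ksw wp) (subsetUl _ _) iK.
  exists J; split=> //; first exact: subset_trans JKs Ksw.
    apply: spans_trans sJ _; apply: star_spans; last exact: subsetUr.
    by apply: sub_spans sA; apply: subset_trans AK (subsetUl _ _).
  by apply/subsetP => e /setDP[/(subsetP JKs)/setUP[->|]].
have [D [AD Dw iD sD Ds]] := ext A (subxx _) ATF iA.
have Dis : D \subset inner :|: spokes.
  apply/subsetP => e eD; case: (boolP (e \in A)) => eA.
    by rewrite inE (subsetP Ai).
  by rewrite inE (subsetP Ds) ?orbT // inE eA.
have [_ cD] := spokes_transversal Ai sD Dis sA AD iD.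
have [Z dZ sfZ] := exists_rest Dw iD sD.
have dZs (J : {set {set V}}) : J \subset whole -> [disjoint J & Z].
  by move=> Jw; apply: disjointWl Jw dZ.
have sumZ c a J : J \subset whole ->
    aff_eval c a (J :|: Z) = c + \sum_(e in J) a e + \sum_(e in Z) a e.
  move=> Jw; rewrite /aff_eval -addrA; congr (_ + _).
  rewrite (big_setID J) /= setUK setDUl setDv set0U.
  by have /setDidPl -> : [disjoint Z & J] by rewrite disjoint_sym dZs.
have capZ (J : {set {set V}}) : (J :|: Z) :&: flat = J :&: flat.
  rewrite setIUl; have /disjoint_setI0 : [disjoint Z & flat].
    by rewrite disjoint_sym; apply: dZs.
  by move=> ->; rewrite setU0.
have [s0 s0s] : exists s, s \in spokes.
  have /card_gt0P[i _] : (0 < #|I|)%N by apply: leq_ltn_trans kI.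
  by have [x [y [xys _ _ _]]] := spoke_exists i; exists [set x; y].
have sJ (J : {set {set V}}) s : flat_basis J -> s \in spokes ->
    [/\ s |: J \subset whole, indep (s |: J), spans (s |: J) whole & s \notin J].
  move=> fJ ss; have [Jf iJ sJ] := fJ; split.
  - by rewrite subUset sub1set (subsetP spw) // (subset_trans Jf).
  - exact: spoke_indep.
  - exact: spoke_spans.
  - by move: ss; rewrite inE => /andP[+ _]; apply: contra; apply: (subsetP Jf).
have fTF : flat_basis TF by [].
pose P := TF :\: A.
have cTF : #|TF| = (#|A| + #|P|)%N by rewrite -(cardsID A TF) (setIidPr ATF).
have cDA : #|D| = (#|A| + #|D :\: A|)%N by rewrite -[LHS](cardsID A D) (setIidPr AD).
(* D and TF with one spoke are bases of [whole] of equal size. Since D has at least |I| spokes, TF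
   has at least k rungs. *)
have cDP : #|D :\: A| = #|P|.+1.
  have [h1 h2 h3 h4] := sJ TF s0 fTF s0s; have [_] := sfZ _ h1 h2 h3.
  rewrite cardsU1 h4 cTF cDA /=; clear; lia.
have kP : (k <= #|P|)%N by rewrite -ltnS -cDP (leq_trans kI).
have PAr e : e \in P -> e \in rungs.
  rewrite inE => /andP[eA eTF]; rewrite inE (subsetP TFf) // andbT.
  apply/negP => ei; have /edgesP[x [y [E _]]] := subsetP inner_edges _ ei; subst e.
  case/negP: (indep_nconn iTF eTF).
  by apply: conn_sub (elimT (spansP _ _) sA _ _ ei); rewrite subsetD1 ATF.
(* The valid inequality of the flat, which holds with equality on the forests
   s |: J with J a basis of the flat, and strictly on D. *)
pose c0 : R := #|TF|%:R; pose a0 (e : {set V}) : R := -1 * (e \in flat)%:R.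
have nn0 : nonneg_on_base g c0 a0.
  apply/(nonnegP gsym girr) => T sT; rewrite aff_count mulN1r subr_ge0 ler_nat.
  apply: (@steinitz_edges V g).
  - exact: subset_trans (subsetIr _ _) flat_edges.
  - by apply: indep_sub (sf_indep sT); apply: subsetIl.
  - by apply: spans_sub sTF; apply: subsetIr.
have [sD1 _] := sfZ D Dw iD sD.
have v0 : aff_eval c0 a0 (D :|: Z) != 0.
  rewrite aff_count mulN1r subr_eq0 eqr_nat capZ.
  have : (#|D :&: flat| <= #|A|)%N.
    apply: subset_leq_card; apply/subsetP => e /setIP[eD ef].
    apply: contraLR ef => eA.
    have : e \in spokes by apply: (subsetP Ds); rewrite inE eA.
    by rewrite inE => /andP[].
  move=> le; rewrite neq_ltn; apply/orP; right; apply: leq_ltn_trans le _.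
  by rewrite cTF -{1}(addn0 #|A|) ltn_add2l (leq_trans k0).
(* The flat inequality is not claimed to define a facet; a facet is taken that keeps its zeros but
   not D with Z. *)
have [c [a [fac v1 Za]]] := facet_exists gsym girr nn0 sD1 v0.
have zero J s : flat_basis J -> s \in spokes ->
    c + (a s + \sum_(e in J) a e) + \sum_(e in Z) a e = 0.
  move=> fJ ss; have [h1 h2 h3 h4] := sJ J s fJ ss; have [sT _] := sfZ _ h1 h2 h3.
  have := Za _ sT; rewrite (sumZ c a) // big_setU1 //=; apply.
  have [Jf iJ spJ] := fJ.
  apply/eqP; rewrite eq_le; apply/andP; split; last first.
    by move/(nonnegP gsym girr): nn0; apply.
  rewrite aff_count mulN1r subr_le0 ler_nat capZ.
  apply: (@leq_trans #|J|).
    apply: (@steinitz_edges V g) iTF _; first exact: subset_trans TFf flat_edges.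
    exact: spans_sub TFf spJ.
  by apply: subset_leq_card; rewrite subsetI subsetUr Jf.
have rconst e e' : e \in rungs -> e' \in rungs -> a e = a e'.
  apply: rungs_const => i f f' fr fr' fi fi'.
  have [J JP] := rung_exchange i Ai iA sA.
  have [fJ bJ] := JP f fr fi; have [fJ' bJ'] := JP f' fr' fi'.
  have := zero _ _ bJ s0s; have := zero _ _ bJ' s0s.
  by rewrite !big_setU1 //=; lra.
have sconst s : s \in spokes -> a s = a s0.
  by move=> ss; have := zero _ _ fTF ss; have := zero _ _ fTF s0s; lra.
have [e0 e0P] : exists e, e \in P.
  by apply/card_gt0P; apply: leq_trans kP.
pose al := a e0; pose be := a s0.
have Pal (Q : {set {set V}}) : Q \subset P -> \sum_(e in Q) a e = al * #|Q|%:R.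
  move=> QP; apply: sum_const => e eQ; apply: rconst; apply: PAr => //.
  exact: (subsetP QP).
have Sbe (Q : {set {set V}}) : Q \subset spokes -> \sum_(e in Q) a e = be * #|Q|%:R.
  by move=> Qs; apply: sum_const => e eQ; apply: sconst; apply: (subsetP Qs).
have splitS (K J : {set {set V}}) : K \subset J ->
    \sum_(e in J) a e = \sum_(e in K) a e + \sum_(e in J :\: K) a e.
  by move=> KJ; rewrite (big_setID K) /= (setIidPr KJ).
pose C := c + \sum_(e in A) a e + \sum_(e in Z) a e.
have hyp : C + be + al * #|P|%:R = 0.
  by have := zero _ _ fTF s0s; rewrite (splitS A TF) // (Pal P) // /C -/be; lra.
(* With equal weights D would have the value of TF with one spoke, which is 0. *)
have ab : al != be.
  apply: contra v1 => /eqP ab; rewrite sumZ // (splitS A D) // (Sbe _ Ds) cDP.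
  by rewrite -natr1 -ab; move: hyp; rewrite -ab /C; lra.
(* Beyond A the basis has m rungs of P and |P| + 1 - m spokes; m from 0 to k gives k + 1 distinct
   values. *)
have vals m : (m <= k)%N -> exists2 T, sf T &
    aff_eval c a T = C + be * #|P|.+1%:R + (al - be) * m%:R.
  move=> mk; have [Q QP Qm] := subset_of_card (leq_trans mk kP).
  have QA : A \subset A :|: Q by apply: subsetUl.
  have QTF : A :|: Q \subset TF by rewrite subUset ATF (subset_trans QP (subsetDl _ _)).
  have iQ : indep (A :|: Q) := indep_sub QTF iTF.
  have [J [QJ Jw iJ spJ Js]] := ext _ QA QTF iQ.
  have [sT cJ] := sfZ J Jw iJ spJ; exists (J :|: Z) => //.
  have AQ : (A :|: Q) :\: A = Q.
    apply/setP => e; rewrite !inE; case: (boolP (e \in A)) => //= eA.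
    by apply/esym/negP => /(subsetP QP); rewrite inE eA.
  have cAQ : #|A :|: Q| = (#|A| + m)%N.
    by rewrite -(cardsID A (A :|: Q)) (setIidPr QA) AQ Qm.
  have cJs : (#|J :\: (A :|: Q)| + m = #|P|.+1)%N.
    have := cJ; rewrite cDA cDP -(cardsID (A :|: Q) J) (setIidPr QJ) cAQ -addnA.
    by move/addnI; rewrite addnC.
  rewrite sumZ // (splitS (A :|: Q) J) // (splitS A (A :|: Q)) // AQ.
  rewrite (Pal Q) // (Sbe _ Js) Qm -cJs natrD /C; lra.
have [s [ss sP]] := lev c a fac.
pose val m := C + be * #|P|.+1%:R + (al - be) * m%:R.
have : (size [seq val m | m <- iota 0 k.+1] <= size s)%N.
  apply: uniq_leq_size.
    rewrite map_inj_in_uniq ?iota_uniq // => m n _ _ /addrI/mulfI.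
    by rewrite subr_eq0 => /(_ ab)/eqP; rewrite eqr_nat => /eqP.
  move=> _ /mapP[m + ->]; rewrite mem_iota add0n ltnS => /andP[_ mk].
  by have [T sT vT] := vals m mk; rewrite /val -vT; apply/sP/(sfP gsym girr).
by rewrite size_map size_iota ltnNge ss.
Qed.

End ConeModel.

Theorem theorem5p6 (R : realFieldType) (k : nat) (hk : (1 <= k)%N)
  (V : finType) (g : rel V) (gsym : symmetric g) (girr : irreflexive g) :
  k_level R g k <->
  ~ (exists h : rel 'I_k.+1,
       [/\ symmetric h, irreflexive h, minimally_biconnected h &
           has_minor g (cone h)]).
Proof.
split=> [lev [h [hs hi [bh _] [B [B0 Bd Bc Be]]]]|nm c a fac].
  by apply: (cone_level gsym girr hi bh B0 Bd Bc Be hk _ lev); rewrite card_ord.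
apply: NNPP => no; apply: nm; apply: (facet_levels gsym girr fac hk) => s ss.
apply: NNPP => no'; apply: no; exists s; split=> // T /(sfP gsym girr) sT.
by apply/negPn/negP => n; apply: no'; exists T.
Qed.
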